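(* For any data tensor network $G_D$ with set of edges to be sketched $\bar E$ and given contraction tree $T_0$ of $G_D$, the asymptotic cost $c$ of the Sketching Algorithm on $(G_D,T_0)$ satisfies $$c=O\left(\sqrt m\cdot c_{\mathrm{opt}}\right),$$ where $m=\Theta(N\log(1/\delta)/\epsilon^2)$ and $c_{\mathrm{opt}}$ is the optimal asymptotic computational cost for the problem of minimizing $C(T_B)$ over all embeddings $G_E\in\mathcal G^{(\epsilon,\delta)}$ and all contraction trees $T_B$ of $(G_D,G_E)$ constrained on $T_0$. When $G_D$ is a graph, $c=O\left(m^{0.375}\cdot c_{\mathrm{opt}}\right)$.
   Context: **Tensor networks.** A tensor network is an undirected hypergraph $G=(V,E,w)$: each vertex is a tensor, each hyperedge a tensor dimension, $w(e)\ge0$ the natural log of the dimension size. A hyperedge is uncontracted if it has a dangling end (not adjacent to a vertex), and contracted otherwise (adjacent to at least two vertices). It is a graph if each contracted edge is adjacent to exactly two vertices and each uncontracted edge to exactly one. **Data and embedding.** The data $G_D=(V_D,E_D,w)$ is a hypergraph tensor network with a set $\bar E=\{e_1,\dots,e_N\}\subseteq E_D$ of uncontracted edges to be sketched; $e_j$ is adjacent to exactly one vertex $v_j\in V_D$, the $v_j$ are distinct, and $s_j=\exp(w(e_j))$. Data vertices not adjacent to $\bar E$ are allowed. An embedding is a graph tensor network $G_E=(V_E,E_E,w)$, $N_E=|V_E|$, with $\bar E\subseteq E_E$: in the combined network $e_j$ joins $v_j$ to an embedding vertex; the other edges of $E_E$ join two embedding vertices (parallel edges allowed) or are uncontracted output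 edges $E_1\subset E_E$ adjacent to one embedding vertex. The sketch size is $m=\exp(\sum_{e\in E_1}w(e))$. Standing assumption: each $s_j>m$. The combined network is $G=(V,E,w)$, $V=V_E\cup V_D$, $E=E_E\cup E_D$; also $L=(V,E_E,w)$, $R=(V,E\setminus E_E,w)$. **Cuts and cost.** For a (hyper)graph $H$ on $V$ and disjoint $A,B\subseteq V$: $\mathrm{cut}_H(A,B)$ is the total weight of hyperedges adjacent to both $A$ and $B$; $\mathrm{cut}_H(A,* )$ the total weight of uncontracted hyperedges adjacent only to vertices of $A$; $\mathrm{cut}_H(A)=\mathrm{cut}_H(A,V\setminus A)+\mathrm{cut}_H(A,* )$. $\mathrm{cost}_H(A,B)=\mathrm{cut}_H(A)+\mathrm{cut}_H(B)-\mathrm{cut}_H(A,B)$. **Contraction trees.** A contraction tree of a network on $V$ is a rooted binary tree whose vertices are subsets of $V$, leaves are singletons, the root is $V$, and each internal vertex $W$ is the disjoint union of its children $W_1,W_2$ (the contraction $(W_1,W_2)$). Contracting $(W_1,W_2)$ costs $\exp(\mathrm{cost}_G(W_1,W_2))$ (classical dense matrix multiplication), and $C(T_B)$ is the sum over all contractions. $T_B$ for $(G_D,G_E)$ is constrained on $T_0$ (a contraction tree of $G_D$) if for each $(A,B)\in T_0$ there is $(\hat A,\hat B)\in T_B$ with $\hat A\cap V_D=A$, $\hat B\cap V_D=B$. $O,\Omega,\Theta$ hide absolute constants. **Class $\mathcal G^{(\epsilon,\delta)}$.** A sketching linearization $G_S$ is obtained by choosing an ordering of $V$ in which data vertices precede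 embedding vertices, and directing every contracted edge of $L$ to its higher-indexed endpoint and every uncontracted edge outward; $\mathrm{cut}_{G_S}(v)$ is the total weight of edges leaving $v$ (including outward dangling ones). $\mathcal G^{(\epsilon,\delta)}$ is the set of Gaussian embeddings (independent tensors with i.i.d. normalized Gaussian entries) with $|E_1|=1$, $m=\Theta(N_E\log(1/\delta)/\epsilon^2)$, for which some sketching linearization has effective sketch dimension of size $\Omega(N_E\log(1/\delta)/\epsilon^2)$ at each embedding vertex, taken as $\mathrm{cut}_{G_S}(v)\ge\log m$ for all $v\in V_E$. **Notation for $T_0$.** Write a topological order of $T_0$ as $(U_1,V_1),\dots,(U_{N_D-1},V_{N_D-1})$, $N_D=|V_D|$, and let $a_i=\exp(\mathrm{cut}_R(U_i)-\mathrm{cut}_R(U_i,V_i))$, $c_i=\exp(\mathrm{cut}_R(V_i)-\mathrm{cut}_R(U_i,V_i))$, $d_i=\exp(\mathrm{cut}_R(U_i\cup V_i))/(a_ic_i)$, $b_i=\exp(\mathrm{cut}_R(U_i,V_i))/d_i$. The contractions are partitioned into: $\mathcal S$, those with both $U_i$ and $V_i$ adjacent to edges of $\bar E$; $\mathcal D(e_j)$, those for which $e_j$ is the only edge of $\bar E$ adjacent to $U_i\cup V_i$; $\mathcal I$, the remaining ones (neither side adjacent to $\bar E$, or one side adjacent to at least two edges of $\bar E$ and the other to none). $X(e_j)$ is the sub network contracted by $\mathcal D(e_j)$: its tensors are $v_j$ and, for $i\in\mathcal D(e_j)$, the (possibly intermediate) tensor among $U_i,V_i$ not adjacent to $e_j$;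 $X(e_j)=v_j$ if $\mathcal D(e_j)=\emptyset$. **Sketching Algorithm**, with $m=\Theta(N\log(1/\delta)/\epsilon^2)$. (1) For each $j$, $X(e_j)$ is contracted together with one Gaussian $s_j\times m$ matrix attached to $e_j$, following the contractions $\mathcal D(e_j)$ and applying the matrix at the step that gives the lowest asymptotic cost (directly to $v_j$ if $\mathcal D(e_j)=\emptyset$). (2) The contractions of $\mathcal S\cup\mathcal I$ are executed in order on the current (sketched) tensors. For $i\in\mathcal I$, simply contract. For $i\in\mathcal S$, let $\hat U_i,\hat V_i$ be the already sketched versions of $U_i,V_i$, each carrying sketched dimension of total size $m$, and sketch $(\hat U_i,\hat V_i)$ with a small network of two Gaussian tensors. If $a_i\le c_i$: tensor $z_1$ is connected to $\hat U_i$ (total size $m$), to $\hat V_i$ (size $\alpha$) and to a tensor $z_2$ (size $m$); $z_2$ is also connected to $\hat V_i$ (size $m/\alpha$) and has an output of size $m$; the contraction order is $(((\hat U_i,z_1),\hat V_i),z_2)$ and $\alpha\in[1,m]$ is chosen to minimize its cost (i.e. $\sqrt{c_im/b_i}$ truncated to $[1,m]$). If $a_i>c_i$: the same with the roles of $(\hat U_i,a_i)$ and $(\hat V_i,c_i)$ exchanged. The sketched dimension of $\hat V_i$ (resp. $\hat U_i$) is split into two parallel edges of sizes $\alpha$, $m/\alpha$; integrality of sizes is ignored. The cost of the algorithm is the total cost of all these contractions.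
   Formalization: The optimum c_opt is taken over embeddings whose own sketch size is also at least a constant times the algorithm's m (so N_E = Ω(N)); without this link between the two uses of m, an embedding with N_E = 2 and a much smaller sketch size contradicts the claim. *)

(* Defs.v *)
From HB Require Import structures.
From mathcomp Require Import all_boot all_order all_algebra.
From mathcomp Require Import reals constructive_ereal ereal sequences exp.

Set Implicit Arguments.
Unset Strict Implicit.
Unset Printing Implicit Defensive.

Import Order.TTheory GRing.Theory Num.Theory.

Local Open Scope ring_scope.

(** * Tensor networks *)

(* [weight e] is the natural logarithm of the size of the dimension [e];
   sizes are real numbers, integrality is ignored throughout.  [dangling e]
   says that [e] is uncontracted. *)
Record network (R : realType) (V : finType) := Network {
  edge : finType;
  ends : edge -> {set V};
  dangling : pred edge;
  weight : edge -> R }.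

Arguments ends {R V} n _.
Arguments dangling {R V} n _.
Arguments weight {R V} n _.

Definition tensor_network (R : realType) (V : finType) (H : network R V) : Prop :=
  forall e : edge H,
    0 <= weight H e /\ ((if dangling H e then 1 else 2) <= #|ends H e|)%N.

Definition is_graph (R : realType) (V : finType) (H : network R V) : Prop :=
  forall e : edge H, #|ends H e| = (if dangling H e then 1 else 2)%N.

Definition subnetwork (R : realType) (V : finType) (H : network R V)
    (F : {set edge H}) : network R V :=
  @Network R V {e : edge H | e \in F}
    (fun e => ends H (val e)) (fun e => dangling H (val e))
    (fun e => weight H (val e)).

Definition touches (R : realType) (V : finType) (H : network R V)
    (e : edge H) (A : {set V}) : bool :=
  ~~ [disjoint ends H e & A].

Definition cut_between (R : realType) (V : finType) (H : network R V)
    (A B : {set V}) : R :=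
  \sum_(e : edge H | touches e A && touches e B) weight H e.

Definition cut_dangling (R : realType) (V : finType) (H : network R V)
    (A : {set V}) : R :=
  \sum_(e : edge H | dangling H e && (ends H e \subset A)) weight H e.

Definition net_cut (R : realType) (V : finType) (H : network R V) (A : {set V}) : R :=
  cut_between H A (~: A) + cut_dangling H A.

Definition cost (R : realType) (V : finType) (H : network R V)
    (A B : {set V}) : R :=
  net_cut H A + net_cut H B - cut_between H A B.

(** * Contraction trees *)

(* A node of the tree stands for the set of the leaves below it. *)
Inductive ctree (V : Type) : Type :=
  | Leaf of V
  | Node of ctree V & ctree V.

Fixpoint leaves (V : Type) (T : ctree V) : seq V :=
  match T with
  | Leaf v => [:: v]
  | Node l r => leaves l ++ leaves r
  end.

Definition leaf_set (V : finType) (T : ctree V) : {set V} := [set v in leaves T].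

Definition contraction_tree (V : finType) (T : ctree V) : Prop :=
  perm_eq (leaves T) (enum V).

(* The two components of a contraction are listed in an arbitrary order. *)
Fixpoint contractions (V : finType) (T : ctree V) : seq ({set V} * {set V}) :=
  match T with
  | Leaf _ => [::]
  | Node l r => (leaf_set l, leaf_set r) :: contractions l ++ contractions r
  end.

Definition tree_cost (R : realType) (V : finType) (H : network R V)
    (T : ctree V) : R :=
  \sum_(p <- contractions T) expR (cost H p.1 p.2).

(** * Data and embeddings *)

Record data (R : realType) := Data {
  dvertex : finType;
  dnet : network R dvertex;
  nsk : nat;
  sk : 'I_nsk -> edge dnet;
  skv : 'I_nsk -> dvertex;
  dnet_tn : tensor_network dnet;
  nsk_gt0 : (0 < nsk)%N;
  sk_dangling : forall j, dangling dnet (sk j);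
  sk_ends : forall j, ends dnet (sk j) = [set skv j];
  skv_inj : injective skv }.

Definition dim_size (R : realType) (D : data R) (j : 'I_(nsk D)) : R :=
  expR (weight (dnet D) (sk j)).

(* [enet] carries the embedding edges other than the sketched ones; the
   sketched edge [sk j] is an edge of the embedding ending at [attach j].
   Costs only depend on the shape of the network, so the (Gaussian) law of the
   entries of the embedding tensors is not recorded. *)
Record embedding (R : realType) (D : data R) := Embedding {
  evertex : finType;
  enet : network R evertex;
  attach : 'I_(nsk D) -> evertex;
  enet_tn : tensor_network enet;
  enet_graph : is_graph enet }.

Definition sketch_size (R : realType) (D : data R) (G : embedding D) : R :=
  expR (\sum_(f : edge (enet G) | dangling (enet G) f) weight (enet G) f).

Definition combined (R : realType) (D : data R) (G : embedding D) :
    network R (dvertex D + evertex G)%type :=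
  @Network R (dvertex D + evertex G)%type (edge (dnet D) + edge (enet G))%type
    (fun e => match e with
      | inl f => (inl @: ends (dnet D) f) :|:
                 [set inr (attach G j) | j : 'I_(nsk D) & sk j == f]
      | inr f => inr @: ends (enet G) f
      end)
    (fun e => match e with
      | inl f => dangling (dnet D) f && (f \notin codom (@sk R D))
      | inr f => dangling (enet G) f
      end)
    (fun e => match e with
      | inl f => weight (dnet D) f
      | inr f => weight (enet G) f
      end).

Definition embedding_edges (R : realType) (D : data R) (G : embedding D) :
    {set edge (combined G)} :=
  [set e : edge (combined G) |
    match e with inl f => f \in codom (@sk R D) | inr _ => true end].

Definition netL (R : realType) (D : data R) (G : embedding D) :=
  subnetwork (embedding_edges G).

(* The network R is restricted here to the data vertices: none of its edges
   reaches an embedding vertex. *)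
Definition netR (R : realType) (D : data R) : network R (dvertex D) :=
  subnetwork [set e : edge (dnet D) | e \notin codom (@sk R D)].

Definition data_part (R : realType) (D : data R) (G : embedding D)
    (A : {set dvertex D + evertex G}) : {set dvertex D} :=
  [set v | inl v \in A].

Definition constrained (R : realType) (D : data R) (G : embedding D)
    (TB : ctree (dvertex D + evertex G)%type) (T0 : ctree (dvertex D)) : Prop :=
  forall A B : {set dvertex D}, (A, B) \in contractions T0 ->
    exists A' B' : {set dvertex D + evertex G},
      [/\ ((A', B') \in contractions TB) \/ ((B', A') \in contractions TB),
          data_part A' = A & data_part B' = B].

(** * The class of embeddings *)

(* A linear ordering is given by an injective rank function. *)
Definition sketch_order (R : realType) (D : data R) (G : embedding D)
    (rk : dvertex D + evertex G -> nat) : Prop :=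
  injective rk /\
  forall (v : dvertex D) (z : evertex G), (rk (inl v) < rk (inr z))%N.

Definition out_cut (R : realType) (D : data R) (G : embedding D)
    (rk : dvertex D + evertex G -> nat) (x : (dvertex D + evertex G)%type) : R :=
  \sum_(e : edge (netL G) | (x \in ends (netL G) e) &&
        (dangling (netL G) e || [exists y in ends (netL G) e, (rk x < rk y)%N]))
    weight (netL G) e.

Definition theta (R : realType) (k1 k2 x y : R) : Prop :=
  k1 * y <= x /\ x <= k2 * y.

Definition gaussian_class (R : realType) (D : data R) (k1 k2 eps del : R)
    (G : embedding D) : Prop :=
  [/\ #|[set f | dangling (enet G) f]| = 1%N,
      theta k1 k2 (sketch_size G) (#|evertex G|%:R * ln (1 / del) / eps ^+ 2)
    & exists2 rk, sketch_order rk &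
        forall z : evertex G, ln (sketch_size G) <= @out_cut R D G rk (inr z)].

(* The sketch size of the competing embeddings and the sketch size [m] of the
   algorithm are one and the same quantity, up to constants: the condition
   [k1 * m <= sketch_size G] rules out embeddings having far fewer vertices
   than there are sketched edges, whose sketch size would be of a smaller
   order than [m]. *)
Definition c_opt (R : realType) (D : data R) (k1 k2 eps del m : R)
    (T0 : ctree (dvertex D)) : \bar R :=
  ereal_inf (fun x : \bar R =>
    exists (G : embedding D) (TB : ctree (dvertex D + evertex G)%type),
      [/\ gaussian_class k1 k2 eps del G, k1 * m <= sketch_size G,
          contraction_tree TB, constrained TB T0
        & x = (tree_cost (combined G) TB)%:E]).

(** * The sketching algorithm *)

Section Algorithm.
Variables (R : realType) (D : data R) (m : R).
Implicit Types (A U V W : {set dvertex D}) (p : {set dvertex D} * {set dvertex D}).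

Definition sk_in A : {set 'I_(nsk D)} := [set j | skv j \in A].

Definition in_S p : bool := (0 < #|sk_in p.1|)%N && (0 < #|sk_in p.2|)%N.
Definition in_D (j : 'I_(nsk D)) p : bool := sk_in (p.1 :|: p.2) == [set j].
Definition in_I p : bool := ~~ in_S p && [forall j, ~~ in_D j p].

Definition size_a U V : R := expR (net_cut (netR D) U - cut_between (netR D) U V).
Definition size_c U V : R := expR (net_cut (netR D) V - cut_between (netR D) U V).
Definition size_d U V : R :=
  expR (net_cut (netR D) (U :|: V)) / (size_a U V * size_c U V).
Definition size_b U V : R := expR (cut_between (netR D) U V) / size_d U V.

Variable T0 : ctree (dvertex D).

(* Contracting X(e_j) with the Gaussian matrix of [e_j], applied to the tensor
   [W]: the contractions that produce [W] see the original size of [e_j], the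
   later ones see the sketched size. *)
Definition X_cost_at (j : 'I_(nsk D)) W : R :=
  expR (net_cut (netR D) W) * dim_size j * m +
  \sum_(p <- contractions T0 | in_D j p)
    expR (cost (netR D) p.1 p.2) *
      (if p.1 :|: p.2 \subset W then dim_size j else m).

(* [W] ranges over [v_j] and the results of the contractions of D(e_j). *)
Definition X_cost (j : 'I_(nsk D)) : R :=
  \big[Num.min/X_cost_at j [set skv j]]_(p <- contractions T0 | in_D j p)
    X_cost_at j (p.1 :|: p.2).

Definition I_cost p : R :=
  expR (cost (netR D) p.1 p.2) *
    (if sk_in (p.1 :|: p.2) == finset.set0 then 1 else m).

End Algorithm.

Section SketchedContraction.
Variable R : realType.

Definition tU : 'I_4 := @Ordinal 4 0 isT.
Definition tV : 'I_4 := @Ordinal 4 1 isT.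
Definition tz1 : 'I_4 := @Ordinal 4 2 isT.
Definition tz2 : 'I_4 := @Ordinal 4 3 isT.

(* Dimensions of the four tensors: adjacent tensors, whether the dimension
   remains after the four tensors are contracted, and size. *)
Definition sketch_dims (a b c d m al : R) : 9.-tuple ({set 'I_4} * bool * R) :=
  [tuple ([set tU], true, a);
         ([set tU; tV], false, b);
         ([set tV], true, c);
         ([set tU; tV], true, d);
         ([set tU; tz1], false, m);
         ([set tz1; tV], false, al);
         ([set tz1; tz2], false, m);
         ([set tz2; tV], false, m / al);
         ([set tz2], true, m)].

Definition sketch_net (a b c d m al : R) : network R 'I_4 :=
  @Network R 'I_4 'I_9
    (fun e => (tnth (sketch_dims a b c d m al) e).1.1)
    (fun e => (tnth (sketch_dims a b c d m al) e).1.2)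
    (fun e => ln (tnth (sketch_dims a b c d m al) e).2).

Definition sketch_tree : ctree 'I_4 :=
  Node (Node (Node (Leaf tU) (Leaf tz1)) (Leaf tV)) (Leaf tz2).

Definition alpha (b c m : R) : R :=
  Num.max 1 (Num.min m (Num.sqrt (c * m / b))).

Definition sketched_cost (a b c d m : R) : R :=
  tree_cost (sketch_net a b c d m (alpha b c m)) sketch_tree.

Definition S_cost (D : data R) (m : R)
    (p : {set dvertex D} * {set dvertex D}) : R :=
  let: (U, V) := p in
  let a := size_a U V in let b := size_b U V in
  let c := size_c U V in let d := size_d U V in
  if a <= c then sketched_cost a b c d m else sketched_cost c b a d m.

Definition alg_cost (D : data R) (m : R) (T0 : ctree (dvertex D)) : R :=
  \sum_(j < nsk D) X_cost m T0 j +
  \sum_(p <- contractions T0 | in_S p) S_cost m p +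
  \sum_(p <- contractions T0 | in_I p) I_cost m p.

End SketchedContraction.

(* Main.v *)
Require Import Defs.
From mathcomp Require Import all_boot all_order all_algebra.
From mathcomp Require Import reals constructive_ereal ereal sequences exp.
From mathcomp Require Import ring lra.
Import Order.TTheory GRing.Theory Num.Theory.
Local Open Scope ring_scope.

(** Fix an embedding of the class with a tree [TB] constrained on [T0], and let [C]
be the cost of [TB].  The theorem compares the cost of the algorithm with [C];
up to a constant factor [kappa], the sketch size [m] is at most [expR lam].

Orient the embedding edges upwards along the linearization.  Call a vertex
active if it is an embedding vertex or the data end of a sketched edge.  Every
active vertex has outgoing weight at least [lam], and no edge is an out-edge of two
vertices.  The vertex of highest rank in a set sends all its
out-edges out of the set.  So a tensor containing an active vertex carries
dimensions of total size at least [expR lam], and contracting two such tensors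
costs at least [expR lam ^+ 2] times the cost of the data dimensions
([flow_cost_ge1], [flow_cost_ge2]).

Since [TB] is constrained on [T0], each contraction of [T0] is realized by one of
[TB], and a contraction of [TB] realizes at most two ([sum_realized_cost]).  This
pays for the class I, and for the part [a b c d m^2] of the cost of a contraction
of the class S.  For X(e_j), consider the contraction of [TB] in which v_j meets
the embedding vertex attached to e_j: the tensors containing v_j before it still
carry e_j at its full size, so applying the Gaussian matrix at that point, or at
the end of D(e_j) if the meeting comes later, is up to a constant not more
expensive than what [TB] does ([sketch_edge_charge]).

For a contraction of the class S with [a <= c], the choice of alpha makes the cost
of the algorithm at most [2 a d m^2 (b c + sqrt(b c m))].  This is at most
[4 sqrt m] times [a b c d m^2], which gives the first bound.  When the data is a
graph, [d <= 1].  If [b c >= m^(1/4)], only a factor [m^(3/8)] is lost.  Otherwise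
[a d sqrt(b c) <= m^(3/8)], so the cost is at most a multiple of
[m^(3/8) * m^(5/2)], and it remains to show that [TB] pays a multiple of [m^(5/2)]
for each of the [N - 1] contractions that merge two sets of sketched edges
([merges_are_expensive]).  Consider such a contraction [P] in the tree
restricted to active vertices.  The contraction that built the child of [P]
containing its highest vertex and the contraction that consumes the result of [P]
count together five sets of out-edges, so their logarithmic costs add up to at
least [5 lam] ([sandwich_cost]) and one of them costs [expR (5/2 lam)].  When one of
the two does not exist, [P] itself takes its place ([both_exit_cost],
[root_cost]).
An induction on the tree checks that each contraction is charged boundedly often
([branch_merges_le]). *)

Set Implicit Arguments.
Unset Strict Implicit.
Unset Printing Implicit Defensive.

(** * Contraction trees *)

Section Trees.
Context {V : finType}.
Implicit Types (T : ctree V) (A X Y : {set V}) (p q : {set V} * {set V}).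

Lemma leaf_set_Node T1 T2 :
  leaf_set (Node T1 T2) = leaf_set T1 :|: leaf_set T2.
Proof. by apply/setP => x; rewrite !inE /= mem_cat. Qed.

Lemma leaf_setE T x : (x \in leaf_set T) = (x \in leaves T).
Proof. by rewrite inE. Qed.

Lemma leaf_set_Leaf (v : V) : leaf_set (Leaf v) = [set v].
Proof. by apply/setP => x; rewrite !inE. Qed.

Lemma leaf_set_neq0 T : exists x, x \in leaf_set T.
Proof.
elim: T => [v|l [x xl] r _]; first by exists v; rewrite leaf_setE /= mem_seq1.
by exists x; rewrite leaf_set_Node inE xl.
Qed.

Lemma leaf_set_disjoint T1 T2 :
  uniq (leaves (Node T1 T2)) -> [disjoint leaf_set T1 & leaf_set T2].
Proof.
rewrite /= cat_uniq => /and3P[_ /hasPn nint _].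
rewrite disjoint_sym; apply/pred0P => x /=; apply/negbTE/negP => /andP[].
by rewrite !leaf_setE => /nint /= /negbTE ->.
Qed.

Lemma uniq_leaves_l {T1 T2} : uniq (leaves (Node T1 T2)) -> uniq (leaves T1).
Proof. by rewrite /= cat_uniq => /and3P[]. Qed.

Lemma uniq_leaves_r {T1 T2} : uniq (leaves (Node T1 T2)) -> uniq (leaves T2).
Proof. by rewrite /= cat_uniq => /and3P[]. Qed.

Lemma uniq_leaves_swap T1 T2 :
  uniq (leaves (Node T1 T2)) -> uniq (leaves (Node T2 T1)).
Proof. by rewrite /= uniq_catC. Qed.

Lemma leaf_set_swap T1 T2 : leaf_set (Node T1 T2) = leaf_set (Node T2 T1).
Proof. by rewrite !leaf_set_Node finset.setUC. Qed.

Lemma contraction_tree_leaf_set T :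
  contraction_tree T -> leaf_set T = [set: V].
Proof.
by move=> pT; apply/setP => x; rewrite !inE (perm_mem pT) mem_enum.
Qed.

Lemma contraction_tree_uniq T :
  contraction_tree T -> uniq (leaves T).
Proof. by move=> pT; rewrite (perm_uniq pT) enum_uniq. Qed.

Lemma contraction_sub T p :
  p \in contractions T -> p.1 :|: p.2 \subset leaf_set T.
Proof.
elim: T => [//|l IHl r IHr] /=; rewrite inE mem_cat leaf_set_Node.
case/or3P => [/eqP-> //|/IHl h|/IHr h]; apply: subset_trans h _.
  exact: subsetUl.
exact: subsetUr.
Qed.

Lemma contraction_disjoint T p : uniq (leaves T) ->
  p \in contractions T -> [disjoint p.1 & p.2].
Proof.
elim: T => [//|l IHl r IHr] uT /=; rewrite inE mem_cat.
have [ul ur] := (uniq_leaves_l uT, uniq_leaves_r uT).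
by case/or3P => [/eqP-> |/(IHl ul)|/(IHr ur)] //; apply: leaf_set_disjoint.
Qed.

Lemma contraction_side_neq0 T p : p \in contractions T ->
  (exists x, x \in p.1) /\ (exists x, x \in p.2).
Proof.
elim: T => [//|l IHl r IHr] /=; rewrite inE mem_cat.
by case/or3P => [/eqP-> |/IHl //|/IHr //]; split; apply: leaf_set_neq0.
Qed.

Lemma contractions_uniq T : uniq (leaves T) -> uniq (contractions T).
Proof.
elim: T => [//|l IHl r IHr] uT /=.
rewrite cat_uniq (IHl (uniq_leaves_l uT)) (IHr (uniq_leaves_r uT)) andbT /=.
have dlr := leaf_set_disjoint uT.
have [xl xlP] := leaf_set_neq0 l; have [xr xrP] := leaf_set_neq0 r.
apply/andP; split.
  rewrite mem_cat; apply/norP; split; apply/negP => /contraction_sub /subsetP.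
    move=> /(_ xr); rewrite !inE -!leaf_setE xrP orbT => /(_ isT) h.
    by move: (disjointFr dlr h); rewrite xrP.
  move=> /(_ xl); rewrite !inE -!leaf_setE xlP => /(_ isT) h.
  by move: (disjointFr dlr xlP); rewrite h.
apply/hasPn => p pr; apply/negP => pl.
have [[x xp] _] := contraction_side_neq0 pr.
have xU : x \in p.1 :|: p.2 by rewrite inE xp.
have := disjointFr dlr (subsetP (contraction_sub pl) _ xU).
by rewrite (subsetP (contraction_sub pr) _ xU).
Qed.

(** The contraction found is the least common ancestor of the leaves in [A]. *)
Lemma contraction_splitting T A : A \subset leaf_set T -> (1 < #|A|)%N ->
  exists p, [/\ p \in contractions T, A \subset p.1 :|: p.2,
    exists2 x, x \in A & x \in p.1 & exists2 x, x \in A & x \in p.2].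
Proof.
elim: T => [v|l IHl r IHr] sA cA.
  have := subset_leq_card sA; rewrite leqNgt.
  by rewrite (_ : leaf_set _ = [set v]) ?cards1 ?cA //;
     apply/setP => x; rewrite !inE.
rewrite leaf_set_Node in sA.
have [dl|] := boolP [disjoint A & leaf_set l].
  have [|p [pr ? ? ?]] := IHr _ cA.
    apply/subsetP => x xA; have := subsetP sA _ xA; rewrite inE.
    by rewrite (disjointFr dl xA).
  by exists p; split; rewrite //= inE mem_cat pr !orbT.
have [dr|] := boolP [disjoint A & leaf_set r].
  have [|p [pr ? ? ?]] := IHl _ cA.
    apply/subsetP => x xA; have := subsetP sA _ xA; rewrite inE.
    by rewrite (disjointFr dr xA) orbF.
  by exists p; split; rewrite //= inE mem_cat pr !orbT.
move=> /pred0Pn[y /andP[/= yA yr]] /pred0Pn[x /andP[/= xA xl]].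
by exists (leaf_set l, leaf_set r); split;
   rewrite //= ?mem_head //; [exists x | exists y].
Qed.

(** A node below the root is a leaf or the result of an earlier contraction. *)
Lemma contraction_side_cases T p X : p \in contractions T ->
  X = p.1 \/ X = p.2 ->
  (exists x, X = [set x]) \/
  exists2 q, q \in contractions T & X = q.1 :|: q.2.
Proof.
have root T' X' : X' = leaf_set T' -> (exists x, X' = [set x]) \/
    exists2 q, q \in contractions T' & X' = q.1 :|: q.2.
  case: T' => [v|l r] ->; [left; exists v | right; exists (leaf_set l, leaf_set r)].
  - by apply/setP => x; rewrite !inE.
  - by rewrite /= mem_head.
  - exact: leaf_set_Node.
have lift T1 T3 : {subset contractions T1 <= contractions T3} ->
    (exists x, X = [set x]) \/
      (exists2 q, q \in contractions T1 & X = q.1 :|: q.2) ->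
    (exists x, X = [set x]) \/
      (exists2 q, q \in contractions T3 & X = q.1 :|: q.2).
  by move=> s [|[q /s]]; [left | right; exists q].
elim: T => [//|l IHl r IHr] /=; rewrite inE mem_cat.
have sl : {subset contractions l <= contractions (Node l r)}.
  by move=> q ql; rewrite /= inE mem_cat ql orbT.
have sr : {subset contractions r <= contractions (Node l r)}.
  by move=> q qr; rewrite /= inE mem_cat qr !orbT.
case/or3P => [/eqP-> /= [] /root|/IHl h /h|/IHr h /h].
- exact: lift sl.
- exact: lift sr.
- exact: lift sl.
- exact: lift sr.
Qed.

Definition side T X := exists2 p, p \in contractions T & X = p.1 \/ X = p.2.

Lemma side_sub {l r} X : side (Node l r) X ->
  X = leaf_set l \/ X = leaf_set r \/ side l X \/ side r X.
Proof.
case=> p /=; rewrite inE mem_cat => /or3P[/eqP->|pl|pr] /=.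
- by case; [left | right; left].
- by right; right; left; exists p.
- by right; right; right; exists p.
Qed.

Lemma side_leaf_set T X : side T X -> X \subset leaf_set T.
Proof.
case=> p /contraction_sub; rewrite subUset => /andP[? ?].
by case=> ->.
Qed.

(** The nodes of a tree form a laminar family. *)
Lemma side_comparable T X Y : uniq (leaves T) -> side T X -> side T Y ->
  [\/ [disjoint X & Y], X \subset Y | Y \subset X].
Proof.
elim: T => [? _ []//|l IHl r IHr] uT sX sY.
have dlr := leaf_set_disjoint uT.
have far (A B : {set V}) : A \subset leaf_set l -> B \subset leaf_set r -> [disjoint A & B].
  by move=> Al Br; apply: disjointW dlr.
move/side_sub: sX => sX; move/side_sub: sY => sY.
have sl X1 : side l X1 -> X1 \subset leaf_set l by apply: side_leaf_set.
have sr X1 : side r X1 -> X1 \subset leaf_set r by apply: side_leaf_set.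
have cl := IHl (uniq_leaves_l uT); have cr := IHr (uniq_leaves_r uT).
case: sX => [->|[->|[sX|sX]]]; case: sY => [->|[->|[sY|sY]]];
  try by [apply: Or31 | apply: Or32 | apply: Or33 | apply: cl | apply: cr].
- by apply: Or33; apply: sl.
- by apply: Or31; apply: far; last exact: sr.
- by apply: Or31; rewrite disjoint_sym.
- by apply: Or31; rewrite disjoint_sym; apply: far; first exact: sl.
- by apply: Or33; apply: sr.
- by apply: Or32; apply: sl.
- by apply: Or31; apply: far; first exact: sl.
- by apply: Or31; apply: far; [exact: sl | exact: sr].
- by apply: Or31; rewrite disjoint_sym; apply: far; last exact: sr.
- by apply: Or32; apply: sr.
- by apply: Or31; rewrite disjoint_sym; apply: far; [exact: sl | exact: sr].
Qed.

Lemma side_meets_both T X p : uniq (leaves T) -> side T X ->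
  p \in contractions T ->
  (exists2 x, x \in X & x \in p.1) -> (exists2 x, x \in X & x \in p.2) ->
  p.1 :|: p.2 \subset X.
Proof.
move=> uT sX pT [x xX x1] [y yX y2].
have dp := contraction_disjoint uT pT.
have s1 : side T p.1 by exists p => //; left.
have s2 : side T p.2 by exists p => //; right.
have y1 : y \notin p.1 by rewrite (disjointFl dp y2).
have x2 : x \notin p.2 by rewrite (disjointFr dp x1).
rewrite subUset; apply/andP; split.
  case: (side_comparable uT sX s1) => // [d|/subsetP/(_ y yX)].
    by move: (disjointFr d xX); rewrite x1.
  by rewrite (negbTE y1).
case: (side_comparable uT sX s2) => // [d|/subsetP/(_ x xX)].
  by move: (disjointFr d yX); rewrite y2.
by rewrite (negbTE x2).
Qed.

Definition sides q X Y :=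
  q = (X, Y) \/ q = (Y, X).

Lemma sides_contraction T q X Y : uniq (leaves T) ->
  q \in contractions T -> sides q X Y ->
  [/\ side T X, side T Y, [disjoint X & Y] & q.1 :|: q.2 = X :|: Y].
Proof.
move=> uT qT qXY; have := contraction_disjoint uT qT.
case: qXY => eq; move: qT; rewrite eq /= => qT dq; split=> //.
- by exists (X, Y) => //=; left.
- by exists (X, Y) => //=; right.
- by exists (Y, X) => //=; right.
- by exists (Y, X) => //=; left.
- by rewrite disjoint_sym.
- exact: finset.setUC.
Qed.

End Trees.

Section Pruning.
Context {V : finType} {R : realType}.
Variables (act : {set V}) (F : {set V} -> {set V} -> R).
Hypothesis F_ge0 : forall A B, 0 <= F A B.
Hypothesis F_act : forall A B, F (A :&: act) (B :&: act) = F A B.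

(** Restricting a tree to the leaves in [act] deletes the contractions in which one
side becomes empty and keeps the others, so it cannot increase a cost that only
depends on the vertices in [act]. *)
Lemma prune_tree (T : ctree V) : has [in act] (leaves T) ->
  exists2 T', leaves T' = [seq x <- leaves T | x \in act] &
    \sum_(p <- contractions T') F p.1 p.2 <= \sum_(p <- contractions T) F p.1 p.2.
Proof.
have leafE T1 T1' : leaves T1' = [seq x <- leaves T1 | x \in act] ->
    leaf_set T1' = leaf_set T1 :&: act.
  by move=> e; apply/setP => x; rewrite !inE e mem_filter andbC.
have nil s : ~~ has [in act] s -> [seq x <- s | x \in act] = [::].
  by rewrite has_filter negbK => /eqP.
elim: T => [v|l IHl r IHr] /=.
  by rewrite orbF => va; exists (Leaf v); rewrite //= va.
rewrite has_cat big_cons big_cat filter_cat /=.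
have ge0 T1 : 0 <= \sum_(p <- contractions T1) F p.1 p.2 by apply: sumr_ge0.
have [hl|/nil nl] := boolP (has _ (leaves l));
  have [hr|/nil nr] := boolP (has _ (leaves r)) => // _.
- have [l' el cl] := IHl hl; have [r' er cr] := IHr hr.
  exists (Node l' r') => /=; first by rewrite el er.
  by rewrite big_cons big_cat /= (leafE _ _ el) (leafE _ _ er) F_act lerD2l lerD.
- have [l' el cl] := IHl hl; exists l'; first by rewrite nr cats0.
  by apply: le_trans cl _; rewrite addrCA lerDl addr_ge0.
- have [r' er cr] := IHr hr; exists r'; first by rewrite nl.
  by apply: le_trans cr _; rewrite addrA lerDr addr_ge0.
Qed.

End Pruning.

(** Used to charge costs to the contractions of a competing tree: a contraction
charged at most [k] times contributes at most [k] times its cost. *)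
Lemma double_counting {R : realType} (I J : eqType) (k : nat) (s : seq I) (t : seq J)
    (rel : I -> J -> bool) (C : J -> R) :
  (forall q, 0 <= C q) ->
  (forall q, (count (rel^~ q) s <= k)%N) ->
  \sum_(p <- s) \sum_(q <- t | rel p q) C q <= k%:R * \sum_(q <- t) C q.
Proof.
move=> C0 ck.
rewrite (exchange_big_dep predT) //= mulr_sumr; apply: ler_sum => q _.
rewrite big_const_seq iter_addr_0 mulr_natl; exact: ler_wpMn2l.
Qed.

Lemma double_counting_exists {R : realType} (I J : eqType) (k : nat) (s : seq I)
    (t : seq J) (rel : I -> J -> bool) (F : I -> R) (C : J -> R) :
  (forall q, 0 <= C q) ->
  (forall q, (count (rel^~ q) s <= k)%N) ->
  (forall p, p \in s -> exists q, [/\ q \in t, rel p q & F p <= C q]) ->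
  \sum_(p <- s) F p <= k%:R * \sum_(q <- t) C q.
Proof.
move=> C0 ck ex; apply: le_trans (double_counting t C0 ck).
rewrite big_seq [leRHS]big_seq; apply: ler_sum => p /ex[q [qt mq Fp]].
apply: le_trans Fp _.
by rewrite (big_rem q qt) /= mq lerDl sumr_ge0.
Qed.

(** * Cuts and contraction costs *)

Lemma ler_sum_pred {R : realType} (I : finType) (w : I -> R) (P Q : pred I) :
  (forall i, 0 <= w i) -> (forall i, P i -> Q i) ->
  \sum_(i | P i) w i <= \sum_(i | Q i) w i.
Proof.
move=> w0 PQ; rewrite (big_mkcond P) (big_mkcond Q); apply: ler_sum => i _.
by case: ifPn => [/PQ -> //|_]; case: ifP.
Qed.

Section Cuts.
Context {R : realType} {V : finType} (H : network R V).
Implicit Types (e : edge H) (A B : {set V}).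

Lemma touchesP e A : reflect (exists2 x, x \in ends H e & x \in A) (touches e A).
Proof.
apply: (iffP idP) => [/pred0Pn[x /andP[xe xA]]|[x xe xA]]; first by exists x.
by apply/pred0Pn; exists x; rewrite /= xe.
Qed.

Lemma touchesS e A B : A \subset B -> touches e A -> touches e B.
Proof. by move=> /subsetP AB /touchesP[x xe /AB xB]; apply/touchesP; exists x. Qed.

Lemma touchesU e A B : touches e (A :|: B) = touches e A || touches e B.
Proof.
apply/idP/orP => [/touchesP[x xe]|[] ].
- by rewrite inE => /orP[xA|xB]; [left | right]; apply/touchesP; exists x.
- exact/touchesS/subsetUl.
- exact/touchesS/subsetUr.
Qed.

(** The edges counted by [net_cut]. *)
Definition exits e A := touches e A && (touches e (~: A) || dangling H e).

Lemma exits_disjoint e A B : [disjoint A & B] ->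
  touches e A && touches e B = exits e A && exits e B.
Proof.
move=> dAB; rewrite /exits; case tA: (touches e A); case tB: (touches e B) => //.
  have -> : touches e (~: A).
    by apply: touchesS tB; rewrite -disjoints_subset disjoint_sym.
  by have -> : touches e (~: B) by apply: touchesS tA; rewrite -disjoints_subset.
by rewrite /= andbF.
Qed.

Lemma exitsU e A B : exits e (A :|: B) -> exits e A || exits e B.
Proof.
rewrite /exits touchesU => /andP[tAB] /orP[/touchesP[x xe]|de]; last first.
  by rewrite de !orbT !andbT.
rewrite !inE negb_or => /andP[xA xB].
have -> : touches e (~: A) by apply/touchesP; exists x; rewrite ?inE.
have -> : touches e (~: B) by apply/touchesP; exists x; rewrite ?inE.
by rewrite !andbT.
Qed.

Hypothesis ends_neq0 : forall e, ends H e != finset.set0.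

Lemma net_cutE A : net_cut H A = \sum_(e | exits e A) weight H e.
Proof.
rewrite /net_cut /cut_between /cut_dangling [RHS](bigID (fun e => touches e (~: A))) /=.
congr (_ + _); apply: eq_bigl => e; rewrite /exits.
  by case: (touches e A); case: (touches e (~: A)) => //=; rewrite andbF.
have -> : touches e (~: A) = ~~ (ends H e \subset A).
  by rewrite /touches disjoints_subset finset.setCK.
case: (boolP (ends H e \subset A)) => [sA|_]; last by rewrite !andbF.
rewrite /= !andbT; suff -> : touches e A by [].
have /set0Pn[x xe] := ends_neq0 e.
by apply/touchesP; exists x => //; apply: (subsetP sA).
Qed.

(** Inclusion-exclusion: by disjointness the edges between [A] and [B] are those
that leave both sets. *)
Lemma costE A B : [disjoint A & B] ->
  cost H A B = \sum_(e | exits e A || exits e B) weight H e.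
Proof.
move=> dAB; rewrite /cost !net_cutE.
have -> : cut_between H A B = \sum_(e | exits e A && exits e B) weight H e.
  by apply: eq_bigl => e; rewrite exits_disjoint.
rewrite (big_mkcond (exits^~ A)) (big_mkcond (exits^~ B)).
rewrite (big_mkcond (fun e => _ && _)) (big_mkcond (fun e => _ || _)) -big_split -sumrB /=.
apply: eq_bigr => e _; case: (exits e A); case: (exits e B) => /=.
- by rewrite addrK.
- by rewrite subr0 addr0.
- by rewrite subr0 add0r.
- by rewrite subr0 addr0.
Qed.

Hypothesis weight_ge0 : forall e, 0 <= weight H e.

Lemma net_cut_le_costl A B : [disjoint A & B] -> net_cut H A <= cost H A B.
Proof.
by move=> dAB; rewrite net_cutE costE //; apply: ler_sum_pred => // e ->.
Qed.

Lemma net_cutU_le_cost A B : [disjoint A & B] -> net_cut H (A :|: B) <= cost H A B.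
Proof.
by move=> dAB; rewrite net_cutE costE //; apply: ler_sum_pred => // e; apply: exitsU.
Qed.

Lemma cut_between_le_net_cut A B : [disjoint A & B] -> cut_between H A B <= net_cut H A.
Proof.
move=> dAB; rewrite net_cutE; apply: ler_sum_pred => // e.
by rewrite exits_disjoint // => /andP[].
Qed.

Lemma cost_ge0 A B : [disjoint A & B] -> 0 <= cost H A B.
Proof. by move=> dAB; rewrite costE //; apply: sumr_ge0. Qed.

(** In a graph no dimension shared by [A] and [B] survives their contraction; this
is what makes the size [d] trivial. *)
Lemma graph_net_cutU A B : is_graph H -> [disjoint A & B] ->
  net_cut H (A :|: B) <=
  (net_cut H A - cut_between H A B) + (net_cut H B - cut_between H A B).
Proof.
move=> gH dAB; rewrite !net_cutE.
have -> : cut_between H A B = \sum_(e | exits e A && exits e B) weight H e.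
  by apply: eq_bigl => e; rewrite exits_disjoint.
rewrite !(big_mkcond (exits^~ _)) /= (big_mkcond (fun e => _ && _)) -!sumrB -big_split /=.
apply: ler_sum => e _.
have noU : exits e A -> exits e B -> ~~ exits e (A :|: B).
  move=> eA eB; apply/negP => /andP[_].
  have := gH e.
  have /andP[/touchesP[x xe xA] /touchesP[y ye yB]] : touches e A && touches e B.
    by rewrite exits_disjoint ?eA.
  have xy : x != y by apply: contraTneq yB => <-; rewrite (disjointFr dAB xA).
  have sxy : [set x; y] \subset ends H e.
    by apply/subsetP => z; rewrite !inE => /orP[] /eqP->.
  have := subset_leq_card sxy; rewrite cards2 xy /=.
  case: (dangling H e) => [+ h|_ ce]; first by rewrite h.
  have /eqP sE : [set x; y] == ends H e by rewrite eqEcard sxy ce cards2 xy.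
  rewrite orbF => /touchesP[z]; rewrite -sE !inE => /orP[] /eqP ->.
    by rewrite xA.
  by rewrite yB orbT.
have := @exitsU e A B; move: noU (weight_ge0 e).
case: (exits e A); case: (exits e B); case: (exits e (A :|: B)) => //= h w h';
  rewrite ?subrr ?subr0 ?addr0 ?add0r ?addr0 ?lexx //; try by have := h isT isT.
- by have := h' isT.
Qed.

End Cuts.

Lemma cut_betweenC {R : realType} {V : finType} (H : network R V) (A B : {set V}) :
  cut_between H A B = cut_between H B A.
Proof. by apply: eq_bigl => e; rewrite andbC. Qed.

Lemma costC {R : realType} {V : finType} (H : network R V) (A B : {set V}) :
  cost H A B = cost H B A.
Proof. by rewrite /cost cut_betweenC [net_cut H A + _]addrC. Qed.

(** * Merging two flows *)

Section WeightedSets.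
Context {R : realType} {E : finType} (w : E -> R).
Hypothesis w_ge0 : forall e, 0 <= w e.
Implicit Types (X Y Z S T : {set E}).

Definition total_weight X : R := \sum_(e in X) w e.

Lemma total_weight_ge0 X : 0 <= total_weight X. Proof. exact: sumr_ge0. Qed.

Lemma total_weightS X Y : X \subset Y -> total_weight X <= total_weight Y.
Proof. by move=> /subsetP XY; apply: ler_sum_pred. Qed.

Lemma total_weightU X Y : [disjoint X & Y] ->
  total_weight (X :|: Y) = total_weight X + total_weight Y.
Proof. by move=> dXY; rewrite /total_weight -bigU //; apply: eq_bigl => e; rewrite !inE. Qed.

Lemma total_weight2_le X Y S : [disjoint X & Y] -> X \subset S -> Y \subset S ->
  total_weight X + total_weight Y <= total_weight S.
Proof. by move=> dXY XS YS; rewrite -total_weightU //; apply: total_weightS; rewrite subUset XS. Qed.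

Lemma total_weight3_le X Y Z S : [disjoint X & Y] -> [disjoint X & Z] -> [disjoint Y & Z] ->
  X \subset S -> Y \subset S -> Z \subset S ->
  total_weight X + total_weight Y + total_weight Z <= total_weight S.
Proof.
move=> dXY dXZ dYZ XS YS ZS; rewrite -total_weightU //; apply: total_weight2_le; rewrite ?subUset ?XS //.
rewrite disjoint_sym disjoints_subset finset.setCU subsetI -!disjoints_subset.
by rewrite disjoint_sym dXZ disjoint_sym.
Qed.

(** [Z] is shared out between [S] and [T], each part being disjoint from the sets
already counted on its side. *)
Lemma total_weight_split5 X1 X2 Y1 Y2 Z S T :
  [disjoint X1 & X2] -> [disjoint X1 & Z] -> [disjoint X2 & Z] ->
  [disjoint Y1 & Y2] -> [disjoint Y1 & Z] -> [disjoint Y2 & Z] ->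
  X1 \subset S -> X2 \subset S -> Y1 \subset T -> Y2 \subset T ->
  Z \subset S :|: T ->
  total_weight X1 + total_weight X2 + total_weight Y1 + total_weight Y2 + total_weight Z
    <= total_weight S + total_weight T.
Proof.
move=> dX dX1 dX2 dY dY1 dY2 X1S X2S Y1T Y2T ZST.
have -> : total_weight Z = total_weight (Z :&: S) + total_weight (Z :\: S).
  rewrite -total_weightU ?finset.setID //; apply/pred0P => e /=; rewrite !inE.
  by case: (e \in S); rewrite ?andbF.
have ZT : Z :\: S \subset T.
  apply/subsetP => e; rewrite !inE => /andP[eS /(subsetP ZST)].
  by rewrite inE (negbTE eS).
have h1 := total_weight3_le dX (disjointWr (finset.subsetIl Z S) dX1)
  (disjointWr (finset.subsetIl Z S) dX2) X1S X2S (finset.subsetIr Z S).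
have h2 := total_weight3_le dY (disjointWr (finset.subsetDl Z S) dY1)
  (disjointWr (finset.subsetDl Z S) dY2) Y1T Y2T ZT.
lra.
Qed.

End WeightedSets.

(** The larger of two numbers is at least half their sum. *)
Lemma expR_half_sum {R : realType} (x y l : R) : 5 * l <= x + y ->
  expR (5 / 2 * l) <= expR x + expR y.
Proof.
move=> xy; have [hx|hx] := lerP (5 / 2 * l) x.
  apply: (@le_trans _ _ (expR x)); first by rewrite ler_expR.
  by rewrite lerDl expR_ge0.
apply: (@le_trans _ _ (expR y)); first by rewrite ler_expR; lra.
by rewrite lerDr expR_ge0.
Qed.

Section Flow.
(** The setting of an embedding, reduced to what the bounds need: [EL] are the
edges of the embedding, [act] its active vertices, [rk] a linearization and [out x]
the edges directed away from [x]. *)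
Context {R : realType} {V : finType} (H : network R V).
Variables (EL : {set edge H}) (act : {set V}) (rk : V -> nat) (lam : R).
Variable out : V -> {set edge H}.
Hypothesis weight_ge0 : forall e : edge H, 0 <= weight H e.
Hypothesis ends_act : forall e : edge H, e \in EL -> ends H e \subset act.
Hypothesis outP : forall x e, e \in out x ->
  [/\ e \in EL, x \in ends H e &
    dangling H e \/ exists2 y, y \in ends H e & (rk x < rk y)%N].
Hypothesis out_disjoint : forall x y, x != y -> [disjoint out x & out y].
Hypothesis out_weight : forall x, x \in act -> lam <= total_weight (weight H) (out x).
Implicit Types (A B C D X : {set V}).

Definition exit_set A : {set edge H} := [set e in EL | exits e A].

(** The part of the logarithm of the cost of contracting [A] with [B] that is due to
the edges in [EL]. *)
Definition flow_cost A B : R := total_weight (weight H) (exit_set A :|: exit_set B).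

Definition is_top A x := [/\ x \in A, x \in act &
  forall y, y \in A -> y \in act -> (rk y <= rk x)%N].

Definition active A := exists2 x, x \in A & x \in act.

Lemma exists_top A : active A -> exists x, is_top A x.
Proof.
case=> x0 x0A x0a.
have [|x /andP[xA xa] xmax] := @arg_maxnP _ x0 [pred x in A | x \in act] rk.
  by rewrite /= x0A.
by exists x; split=> // y yA ya; apply: xmax; rewrite /= yA.
Qed.

(** The heads of the out-edges of a highest active vertex rank too high to lie in
[A]. *)
Lemma top_out A x : is_top A x -> out x \subset exit_set A.
Proof.
case=> xA xa xmax; apply/subsetP => e /outP[eEL xe de]; rewrite inE eEL /=.
have -> /= : exits e A = (touches e (~: A) || dangling H e).
  by rewrite /exits; have -> : touches e A by apply/touchesP; exists x.
case: de => [->|[y ye xy]]; first by rewrite orbT.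
apply/orP; left; apply/touchesP; exists y => //; rewrite inE.
apply/negP => yA; have := xmax _ yA (subsetP (ends_act eEL) _ ye).
by rewrite leqNgt xy.
Qed.

Lemma out_disjointP A B x y : [disjoint A & B] -> x \in A -> y \in B ->
  [disjoint out x & out y].
Proof.
move=> dAB xA yB; apply: out_disjoint; apply: contraTneq yB => <-.
by rewrite (disjointFr dAB xA).
Qed.

Lemma flow_costC A B : flow_cost A B = flow_cost B A.
Proof. by rewrite /flow_cost finset.setUC. Qed.

Lemma flow_cost_ge1 A B : active A -> lam <= flow_cost A B.
Proof.
move=> /exists_top[x tx]; have [_ xa _] := tx.
apply: le_trans (out_weight xa) (total_weightS weight_ge0 _).
exact: subset_trans (top_out tx) (finset.subsetUl _ _).
Qed.

Lemma flow_cost_ge2 A B : [disjoint A & B] -> active A -> active B ->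
  lam + lam <= flow_cost A B.
Proof.
move=> dAB /exists_top[x tx] /exists_top[y ty].
have [xA xa _] := tx; have [yB ya _] := ty.
apply: le_trans (lerD (out_weight xa) (out_weight ya)) (total_weight2_le weight_ge0 _ _ _).
- exact: out_disjointP xA yB.
- exact: subset_trans (top_out tx) (finset.subsetUl _ _).
- exact: subset_trans (top_out ty) (finset.subsetUr _ _).
Qed.

(** An edge leaving [B] either goes to [A], and leaves [A] as well, or it leaves
the union. *)
Lemma out_absorbed A B x : [disjoint A & B] -> x \in B ->
  out x \subset exit_set B -> out x \subset exit_set A :|: exit_set (A :|: B).
Proof.
move=> dAB xB /subsetP oB; apply/subsetP => e ex.
have := oB _ ex; rewrite !inE => /andP[-> /andP[tB]] /=.
rewrite /exits touchesU tB orbT /= => /orP[|->]; last by rewrite !orbT.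
move=> /touchesP[y ye]; rewrite inE => yB.
case yA: (y \in A).
  have -> : touches e A by apply/touchesP; exists y.
  by rewrite (touchesS _ tB) // -disjoints_subset disjoint_sym.
suff -> : touches e (~: (A :|: B)) by rewrite orbT.
by apply/touchesP; exists y => //; rewrite !inE yA.
Qed.

Lemma exit_setU A B : exit_set (A :|: B) \subset exit_set A :|: exit_set B.
Proof.
by apply/subsetP => e; rewrite !inE => /andP[-> /exitsU].
Qed.

(** The contraction of [A] and [B], and the later one of [A :|: B :|: C] with [D],
where [C] was merged in between.  The out-edges of the tops of [A] and [B] are
counted by the first, those of the tops of the union and of [D] by the second.
The out-edges of the top of [C] are a fifth set: each is counted on one of the two
sides by [out_absorbed].  It differs from the set of the top of the union only
because that top lies in [A :|: B]. *)
Lemma sandwich_cost A B C D t :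
  [disjoint A & B] -> [disjoint A :|: B & C] -> [disjoint A :|: B :|: C & D] ->
  active A -> active B -> active C -> active D ->
  is_top (A :|: B :|: C) t -> t \in A :|: B ->
  5 * lam <= flow_cost A B + flow_cost (A :|: B :|: C) D.
Proof.
move=> dAB dABC dD /exists_top[a ta] /exists_top[b tb] /exists_top[c tc].
move=> /exists_top[d td] tt tAB.
have [aA aa _] := ta; have [bB ba _] := tb; have [cC ca _] := tc.
have [dD' da _] := td; have [tABC t_act _] := tt.
have aAB : a \in A :|: B by rewrite inE aA.
have bAB : b \in A :|: B by rewrite inE bB orbT.
have cABC : c \in A :|: B :|: C by rewrite inE cC orbT.
have := @total_weight_split5 _ _ _ weight_ge0 (out a) (out b) (out t) (out d) (out c)
  (exit_set A :|: exit_set B) (exit_set (A :|: B :|: C) :|: exit_set D).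
have -> // : out c \subset exit_set A :|: exit_set B :|:
    (exit_set (A :|: B :|: C) :|: exit_set D).
  apply: subset_trans (out_absorbed dABC cC (top_out tc)) _.
  by apply: finset.setUSS; [exact: exit_setU | exact: finset.subsetUl].
have := out_weight aa; have := out_weight ba; have := out_weight ca.
have := out_weight da; have := out_weight t_act.
rewrite /flow_cost => h1 h2 h3 h4 h5 /(_ (out_disjointP dAB aA bB)).
move=> /(_ (out_disjointP dABC aAB cC) (out_disjointP dABC bAB cC)).
move=> /(_ (out_disjointP dD tABC dD') (out_disjointP dABC tAB cC)).
rewrite disjoint_sym => /(_ (out_disjointP dD cABC dD')).
have -> : out a \subset exit_set A :|: exit_set B.
  exact: subset_trans (top_out ta) (finset.subsetUl _ _).
have -> : out b \subset exit_set A :|: exit_set B.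
  exact: subset_trans (top_out tb) (finset.subsetUr _ _).
have -> : out t \subset exit_set (A :|: B :|: C) :|: exit_set D.
  exact: subset_trans (top_out tt) (finset.subsetUl _ _).
have -> : out d \subset exit_set (A :|: B :|: C) :|: exit_set D.
  exact: subset_trans (top_out td) (finset.subsetUr _ _).
move=> /(_ isT isT isT isT isT) h; lra.
Qed.

(** The variant of [sandwich_cost] when nothing is left to play the part of [D].
There the top of everything has only dangling out-edges, so it owns the unique
dangling edge, and all out-edges of the top of [C] go to [A :|: B]. *)
Lemma root_cost A B C t :
  (forall e e', e \in EL -> e' \in EL -> dangling H e -> dangling H e' -> e = e') ->
  0 < lam ->
  [disjoint A & B] -> [disjoint A :|: B & C] ->
  active A -> active B -> active C -> act \subset A :|: B :|: C ->
  is_top (A :|: B :|: C) t -> t \in A :|: B ->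
  5 * lam <= flow_cost A B + flow_cost (A :|: B) C.
Proof.
move=> dangling1 lam0 dAB dABC /exists_top[a ta] /exists_top[b tb] /exists_top[c tc].
move=> sact tt tAB.
have [aA aa _] := ta; have [bB ba _] := tb; have [cC ca _] := tc.
have [tABC t_act _] := tt.
have aAB : a \in A :|: B by rewrite inE aA.
have bAB : b \in A :|: B by rewrite inE bB orbT.
have not_out e : e \in EL -> touches e (~: (A :|: B :|: C)) = false.
  move=> eEL; apply/negbTE/negP => /touchesP[y].
  by move=> /(subsetP (ends_act eEL)) /(subsetP sact) yU; rewrite inE yU.
have dtc := out_disjointP dABC tAB cC.
have c_contracted e : e \in out c -> dangling H e = false.
  move=> ec; apply/negP => de.
  have : 0 < total_weight (weight H) (out t) by apply: lt_le_trans (out_weight t_act).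
  case: (finset.set_0Vmem (out t)) => [->|[e' et]].
    by rewrite /total_weight finset.big_set0 ltxx.
  have := subsetP (top_out tt) _ et; rewrite inE => /andP[e'EL /andP[_]].
  rewrite not_out //= => de'; have [eEL _ _] := outP ec.
  by move: (disjointFl dtc ec); rewrite (dangling1 e e') // et.
have oc : out c \subset exit_set A :|: exit_set B.
  apply/subsetP => e ec.
  have := subsetP (out_absorbed dABC cC (top_out tc)) _ ec.
  rewrite inE => /orP[/(subsetP (exit_setU _ _)) //|].
  by rewrite inE => /andP[eEL /andP[_]]; rewrite not_out // c_contracted.
have h1 : total_weight (weight H) (out a) + total_weight (weight H) (out b) +
    total_weight (weight H) (out c)
    <= flow_cost A B.
  apply: (total_weight3_le weight_ge0) => //.
  - exact: out_disjointP aA bB.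
  - exact: out_disjointP aAB cC.
  - exact: out_disjointP bAB cC.
  - exact: subset_trans (top_out ta) (finset.subsetUl _ _).
  - exact: subset_trans (top_out tb) (finset.subsetUr _ _).
have h2 : lam + lam <= flow_cost (A :|: B) C.
  by apply: flow_cost_ge2 => //; [exists t | exists c].
have := out_weight aa; have := out_weight ba; have := out_weight ca; lra.
Qed.

(** When the out-edges of a vertex on each side leave the union, the two flows
have not been merged yet, and the next contraction sees both besides the flow out
of [D]. *)
Lemma both_exit_cost A B D x y :
  [disjoint A & B] -> [disjoint A :|: B & D] ->
  x \in A -> x \in act -> y \in B -> y \in act -> active D ->
  out x \subset exit_set (A :|: B) -> out y \subset exit_set (A :|: B) ->
  5 * lam <= flow_cost A B + flow_cost (A :|: B) D.
Proof.
move=> dAB dD xA xa yB ya aD ox oy.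
have h1 : lam + lam <= flow_cost A B.
  by apply: flow_cost_ge2 => //; [exists x | exists y].
have [d td] := exists_top aD; have [dD' da _] := td.
have h2 : total_weight (weight H) (out x) + total_weight (weight H) (out y) +
    total_weight (weight H) (out d)
    <= flow_cost (A :|: B) D.
  apply: (total_weight3_le weight_ge0) => //.
  - exact: out_disjointP xA yB.
  - by apply: out_disjointP dD _ dD'; rewrite inE xA.
  - by apply: out_disjointP dD _ dD'; rewrite inE yB orbT.
  - exact: subset_trans ox (finset.subsetUl _ _).
  - exact: subset_trans oy (finset.subsetUl _ _).
  - exact: subset_trans (top_out td) (finset.subsetUr _ _).
have := out_weight xa; have := out_weight ya; have := out_weight da; lra.
Qed.

(** The sources are the data ends of the sketched edges.  They rank below the
embedding vertices, and their out-edges lead to embedding vertices. *)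
Variable src : {set V}.
Hypothesis src_act : src \subset act.
Hypothesis src_low : forall x y, x \in src -> y \in act -> y \notin src -> (rk x < rk y)%N.
Hypothesis src_out : forall x e, x \in src -> e \in out x ->
  exists2 y, y \in ends H e & y \notin src.
Hypothesis act_not_src : exists2 z, z \in act & z \notin src.
Hypothesis dangling_unique : forall e e', e \in EL -> e' \in EL ->
  dangling H e -> dangling H e' -> e = e'.
Hypothesis lam_gt0 : 0 < lam.

Definition meets_src A := ~~ [disjoint A & src].

Definition merges_src (p : {set V} * {set V}) := meets_src p.1 && meets_src p.2.

Definition merge_count (T : ctree V) := count merges_src (contractions T).

(** The merges strictly below the root: those whose result is consumed by a
contraction of the tree. *)
Definition branch_merge_count (T : ctree V) :=
  if T is Node l r then (merge_count l + merge_count r)%N else 0%N.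

Definition top_cost (T : ctree V) : R :=
  if T is Node l r then expR (flow_cost (leaf_set l) (leaf_set r)) else 0.

(** The cost of the contractions that built the two children of the root. *)
Definition branch_cost (T : ctree V) : R :=
  if T is Node l r then top_cost l + top_cost r else 0.

Definition flow_tree_cost (T : ctree V) : R :=
  \sum_(p <- contractions T) expR (flow_cost p.1 p.2).

Definition expensive := expR (5 / 2 * lam).

Lemma top_cost_ge0 T : 0 <= top_cost T.
Proof. by case: T => //= l r; apply: expR_ge0. Qed.

Lemma branch_cost_ge0 T : 0 <= branch_cost T.
Proof. by case: T => //= l r; apply: addr_ge0; apply: top_cost_ge0. Qed.

Lemma meets_srcP A : reflect (exists2 x, x \in A & x \in src) (meets_src A).
Proof.
apply: (iffP idP) => [/pred0Pn[x /andP[]]|[x xA xd]]; first by exists x.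
by apply/pred0Pn; exists x; rewrite /= xA.
Qed.

Lemma leaf_set_active T : leaf_set T \subset act -> active (leaf_set T).
Proof.
by move=> /subsetP sT; have [x xT] := leaf_set_neq0 T; exists x => //; apply: sT.
Qed.

(** A set of sources has no heads of out-edges, so each of its vertices behaves
like a top. *)
Lemma src_exit A x : A \subset src -> x \in A -> out x \subset exit_set A.
Proof.
move=> /subsetP Ad xA; apply/subsetP => e ex.
have [eEL xe _] := outP ex; have [y ye yd] := src_out (Ad _ xA) ex.
rewrite inE eEL /=; apply/andP; split; first by apply/touchesP; exists x.
apply/orP; left; apply/touchesP; exists y => //; rewrite inE.
by apply: contra yd; apply: Ad.
Qed.

(** If the child [l] holding the top is a single leaf, it is a source, so all
vertices are sources by the choice of ranks and [both_exit_cost] applies;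
otherwise [l] was built by a contraction and [sandwich_cost] applies. *)
Lemma merge_expensive_left l r D t :
  uniq (leaves (Node l r)) -> leaf_set (Node l r) \subset act ->
  [disjoint leaf_set (Node l r) & D] -> active D ->
  meets_src (leaf_set l) -> meets_src (leaf_set r) ->
  is_top (leaf_set (Node l r)) t -> t \in leaf_set l ->
  expensive <= top_cost l + expR (flow_cost (leaf_set l) (leaf_set r)) +
    expR (flow_cost (leaf_set (Node l r)) D).
Proof.
move=> ulr sact dD aD dl dr tt tl.
have dlr := leaf_set_disjoint ulr.
move: (ulr) sact dD tt; rewrite !leaf_set_Node subUset => _ /andP[sl sr] dD tt.
have e0 A B : 0 <= expR (flow_cost A B) by apply: expR_ge0.
have [tlr t_act tmax] := tt.
case: l ulr dl tl dlr sl dD tt tlr tmax => [v|l1 l2] ulr dl tl dlr sl dD tt tlr tmax /=.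
  have h : 5 * lam <= flow_cost (leaf_set (Leaf v)) (leaf_set r) +
      flow_cost (leaf_set (Leaf v) :|: leaf_set r) D.
    move: tl; rewrite leaf_set_Leaf in_set1 => /eqP tv; subst v.
    have td : t \in src.
      by move/meets_srcP: dl => [x]; rewrite leaf_set_Leaf in_set1 => /eqP->.
    have all_src : leaf_set (Leaf t) :|: leaf_set r \subset src.
      apply/subsetP => y yU; have ya : y \in act.
        by apply: (subsetP _ _ yU); rewrite subUset sl.
      apply/negPn/negP => yd; have := src_low td ya yd.
      by rewrite ltnNge tmax.
    have [y yr yd] := meets_srcP _ dr.
    have tU : t \in leaf_set (Leaf t) :|: leaf_set r by rewrite !inE eqxx.
    have yU : y \in leaf_set (Leaf t) :|: leaf_set r by rewrite inE yr orbT.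
    rewrite -leaf_set_Leaf.
    apply: (@both_exit_cost _ _ _ t y) => //.
    - by rewrite leaf_set_Leaf in_set1.
    - exact: (subsetP src_act).
    - exact: src_exit.
    - exact: src_exit.
  have := expR_half_sum h; rewrite /expensive; have := e0 (leaf_set (Leaf v)) (leaf_set r).
  lra.
have ul := uniq_leaves_l ulr.
move: sl dlr dD tt tl; rewrite !leaf_set_Node subUset => /andP[s1 s2] dlr dD tt tl.
have h := sandwich_cost (leaf_set_disjoint ul) dlr dD (leaf_set_active s1)
  (leaf_set_active s2) (leaf_set_active sr) aD tt tl.
have := expR_half_sum h; rewrite /expensive.
have := e0 (leaf_set l1 :|: leaf_set l2) (leaf_set r); lra.
Qed.

(** The top of everything is not a source, so [l] cannot be a leaf. *)
Lemma root_merge_expensive_left l r t :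
  uniq (leaves (Node l r)) -> leaf_set (Node l r) = act ->
  meets_src (leaf_set l) -> meets_src (leaf_set r) ->
  is_top (leaf_set (Node l r)) t -> t \in leaf_set l ->
  expensive <= top_cost l + expR (flow_cost (leaf_set l) (leaf_set r)).
Proof.
move=> ulr eact dl dr tt tl.
have dlr := leaf_set_disjoint ulr.
have [tlr t_act tmax] := tt; move: eact tt tlr; rewrite !leaf_set_Node => eact tt tlr.
have : leaf_set l :|: leaf_set r \subset act by rewrite eact.
rewrite subUset => /andP[sl sr].
case: l ulr dl tl dlr sl tt tlr eact tmax => [v|l1 l2] ulr dl tl dlr sl tt tlr eact tmax /=.
  move: tl; rewrite leaf_set_Leaf in_set1 => /eqP tv; subst v.
  have td : t \in src.
    by move/meets_srcP: dl => [x]; rewrite leaf_set_Leaf in_set1 => /eqP->.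
  have [z za zd] := act_not_src.
  have := src_low td za zd; rewrite ltnNge tmax //.
  by rewrite leaf_set_Node eact.
have ul := uniq_leaves_l ulr.
move: sl dlr eact tt tl; rewrite !leaf_set_Node subUset => /andP[s1 s2] dlr eact tt tl.
apply: expR_half_sum; apply: (@root_cost _ _ _ t) => //.
- exact: leaf_set_disjoint ul.
- exact: leaf_set_active.
- exact: leaf_set_active.
- exact: leaf_set_active.
- by rewrite eact.
Qed.

Lemma merge_expensive l r D :
  uniq (leaves (Node l r)) -> leaf_set (Node l r) \subset act ->
  [disjoint leaf_set (Node l r) & D] -> active D ->
  merges_src (leaf_set l, leaf_set r) ->
  expensive <= top_cost l + top_cost r + expR (flow_cost (leaf_set l) (leaf_set r)) +
    expR (flow_cost (leaf_set (Node l r)) D).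
Proof.
move=> ulr sact dD aD /andP[/= dl dr].
have [t tt] := exists_top (leaf_set_active sact).
have [tlr _ _] := tt; have := tlr; rewrite {1}leaf_set_Node inE => /orP[tl|tr].
  have := merge_expensive_left ulr sact dD aD dl dr tt tl.
  have := top_cost_ge0 r; lra.
move: sact dD tt; rewrite leaf_set_swap => sact dD tt.
have := merge_expensive_left (uniq_leaves_swap ulr) sact dD aD dr dl tt tr.
rewrite [flow_cost (leaf_set r) _]flow_costC; have := top_cost_ge0 l; lra.
Qed.

Lemma root_merge_expensive l r :
  uniq (leaves (Node l r)) -> leaf_set (Node l r) = act ->
  merges_src (leaf_set l, leaf_set r) ->
  expensive <= top_cost l + top_cost r + expR (flow_cost (leaf_set l) (leaf_set r)).
Proof.
move=> ulr eact /andP[/= dl dr].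
have sact : leaf_set (Node l r) \subset act by rewrite eact.
have [t tt] := exists_top (leaf_set_active sact).
have [+ _ _] := tt; rewrite leaf_set_Node inE => /orP[tl|tr].
  have := root_merge_expensive_left ulr eact dl dr tt tl.
  have := top_cost_ge0 r; lra.
move: eact tt; rewrite leaf_set_swap => eact tt.
have := root_merge_expensive_left (uniq_leaves_swap ulr) eact dr dl tt tr.
rewrite flow_costC; have := top_cost_ge0 l; lra.
Qed.

(** A merge is paid by the contractions that built its two children, by itself and by
its parent.  The terms
[top_cost] and [branch_cost] on the left are the credit that a subtree keeps for
the merge at its root, which is charged only when its parent is known. *)
Lemma branch_merges_le T : uniq (leaves T) -> leaf_set T \subset act ->
  expensive * (branch_merge_count T)%:R + 2 * top_cost T + branch_cost T
    <= 4 * flow_tree_cost T.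
Proof.
have ex0 : 0 <= expensive by apply: expR_ge0.
elim: T => [v _ _|l IHl r IHr ulr sact].
  by rewrite /= /flow_tree_cost /= big_nil !mulr0 !addr0.
have dlr := leaf_set_disjoint ulr.
move: (sact); rewrite leaf_set_Node subUset => /andP[sl sr].
have {}IHl := IHl (uniq_leaves_l ulr) sl; have {}IHr := IHr (uniq_leaves_r ulr) sr.
have step T D : uniq (leaves T) -> leaf_set T \subset act ->
    [disjoint leaf_set T & D] -> active D ->
    expensive * (merge_count T)%:R <= expensive * (branch_merge_count T)%:R +
      branch_cost T + top_cost T + expR (flow_cost (leaf_set T) D).
  case: T => [v|a b] uT sT dT aD.
    by rewrite /merge_count /= !mulr0 !add0r expR_ge0.
  rewrite /merge_count /= count_cat natrD mulrDr.
  case: (boolP (merges_src _)) => [m|_] /=.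
    rewrite mulr1; have := merge_expensive uT sT dT aD m; rewrite /merge_count; lra.
  have := branch_cost_ge0 (Node a b); have := top_cost_ge0 (Node a b).
  have := expR_ge0 (flow_cost (leaf_set (Node a b)) D).
  rewrite /= mulr0 add0r /merge_count; lra.
have hl := step _ _ (uniq_leaves_l ulr) sl dlr (leaf_set_active sr).
rewrite disjoint_sym in dlr.
have hr := step _ _ (uniq_leaves_r ulr) sr dlr (leaf_set_active sl).
rewrite flow_costC in hr.
rewrite /flow_tree_cost /= big_cons big_cat /= natrD mulrDr.
move: IHl IHr; rewrite /flow_tree_cost; lra.
Qed.

Lemma card_src_leaves T :
  (#|leaf_set T :&: src| <= (merge_count T).+1)%N.
Proof.
elim: T => [v|l IHl r IHr].
  rewrite (leq_trans (subset_leq_card (finset.subsetIl _ _))) //.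
  by rewrite leaf_set_Leaf cards1.
rewrite /merge_count /= count_cat -/(merge_count l) -/(merge_count r).
rewrite leaf_set_Node finset.setIUl.
have e0 A : ~~ meets_src A -> A :&: src = finset.set0.
  by rewrite negbK -setI_eq0 => /eqP.
rewrite /merges_src /=.
have [ml|/e0->] := boolP (meets_src (leaf_set l)); last first.
  by rewrite finset.set0U (leq_trans IHr) // ltnS leq_addl.
have [mr|/e0->] := boolP (meets_src (leaf_set r)); last first.
  by rewrite finset.setU0 (leq_trans IHl) // ltnS leq_addr.
apply: leq_trans (leq_card_setU _ _) _; apply: leq_trans (leq_add IHl IHr) _.
by rewrite /= addSn addnS add1n.
Qed.

(** A tree with [#|src|] sources has [#|src|.-1] merges. *)
Theorem merges_are_expensive T : uniq (leaves T) -> leaf_set T = act ->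
  expensive * (#|src|.-1)%:R <= 4 * flow_tree_cost T.
Proof.
move=> uT eact.
have ex0 : 0 <= expensive by apply: expR_ge0.
apply: (@le_trans _ _ (expensive * (merge_count T)%:R)).
  apply: ler_wpM2l => //; rewrite ler_nat -ltnS.
  have := card_src_leaves T; rewrite eact (setIidPr src_act).
  by case: #|src|.
have sact : leaf_set T \subset act by rewrite eact.
have := branch_merges_le uT sact.
case: T uT eact sact => [v|l r] uT eact _ /=.
  by rewrite /merge_count /=; lra.
rewrite /merge_count /= count_cat -/(merge_count l) -/(merge_count r).
rewrite natrD mulrDr.
have := expR_ge0 (flow_cost (leaf_set l) (leaf_set r)).
case: (boolP (merges_src _)) => [m|_] /=.
  have := root_merge_expensive uT eact m; lra.
have := top_cost_ge0 l; have := top_cost_ge0 r; lra.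
Qed.

End Flow.

(** * The combined network as a flow *)

Section DataNetwork.
Context {R : realType} (D : data R).
Implicit Types (j : 'I_(nsk D)) (f : edge (dnet D)).

Lemma sk_inj : injective (@sk R D).
Proof.
move=> i j eij; apply: skv_inj; apply/finset.set1P.
by rewrite -sk_ends -eij sk_ends inE.
Qed.

Lemma dnet_ends_neq0 f : ends (dnet D) f != finset.set0.
Proof.
by have [_] := dnet_tn f; rewrite -card_gt0; apply: leq_trans; case: ifP.
Qed.

Lemma netR_ends_neq0 (e : edge (netR D)) : ends (netR D) e != finset.set0.
Proof. exact: dnet_ends_neq0. Qed.

Lemma netR_weight_ge0 (e : edge (netR D)) : 0 <= weight (netR D) e.
Proof. by have [] := dnet_tn (val e). Qed.

End DataNetwork.

Section Combined.
Context {R : realType} {D : data R} (G : embedding D).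
Notation H := (combined G).
Notation EL := (embedding_edges G).
Implicit Types (A B : {set dvertex D + evertex G}) (j : 'I_(nsk D)).

Lemma combined_weight_ge0 (e : edge H) : 0 <= weight H e.
Proof. by case: e => e /=; [have [] := dnet_tn e | have [] := enet_tn e]. Qed.

Lemma combined_ends_neq0 (e : edge H) : ends H e != finset.set0.
Proof.
case: e => e /=.
  have /set0Pn[x xe] := dnet_ends_neq0 e.
  by apply/set0Pn; exists (inl x); rewrite inE imset_f.
have [_ c] := enet_tn e.
have /set0Pn[x xe] : ends (enet G) e != finset.set0.
  by rewrite -card_gt0; apply: leq_trans c; case: ifP.
by apply/set0Pn; exists (inr x); rewrite imset_f.
Qed.

Lemma combined_ends_sk j :
  ends H (inl (sk j)) = [set inl (skv j); inr (attach G j)].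
Proof.
rewrite /= sk_ends imset_set1; congr (_ :|: _).
apply/setP => x; rewrite inE; apply/imsetP/eqP => [[i]|->]; last by exists j; rewrite ?inE.
by rewrite inE => /eqP/sk_inj ->.
Qed.

Definition active_vertices : {set dvertex D + evertex G} :=
  [set x | if x is inl v then v \in codom (@skv R D) else true].

Definition sketched_vertices : {set dvertex D + evertex G} :=
  [set inl (skv j) | j : 'I_(nsk D)].

Lemma sketched_active : sketched_vertices \subset active_vertices.
Proof. by apply/subsetP => x /imsetP[j _ ->]; rewrite inE codom_f. Qed.

Lemma embedding_edge_cases (e : edge H) : e \in EL ->
  (exists j, e = inl (sk j)) \/ (exists f, e = inr f).
Proof.
case: e => f; rewrite inE; last by right; exists f.
by move=> /codomP[j ->]; left; exists j.
Qed.

Lemma embedding_ends_active (e : edge H) : e \in EL -> ends H e \subset active_vertices.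
Proof.
move=> /embedding_edge_cases[[j ->]|[f ->]]; apply/subsetP => x.
  by rewrite combined_ends_sk !inE => /orP[] /eqP-> //; rewrite codom_f.
by move=> /imsetP[z _ ->]; rewrite inE.
Qed.

Variable rk : dvertex D + evertex G -> nat.

Definition out_edges x : {set edge H} :=
  [set e in EL | (x \in ends H e) &&
     (dangling H e || [exists y in ends H e, (rk x < rk y)%N])].

Lemma out_edgesP x e : e \in out_edges x ->
  [/\ e \in EL, x \in ends H e &
    dangling H e \/ exists2 y, y \in ends H e & (rk x < rk y)%N].
Proof.
rewrite inE => /and3P[eE xe /orP[de|/exists_inP[y ye xy]]]; split=> //.
  by left.
by right; exists y.
Qed.

Lemma out_cutE x : out_cut rk x = total_weight (weight H) (out_edges x).
Proof.
rewrite /out_cut /total_weight /netL /=.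
rewrite -(big_sub_cond EL (fun e : edge H => (x \in ends H e) &&
   (dangling H e || [exists y in ends H e, (rk x < rk y)%N])) (fun e => weight H e)).
by apply: eq_bigl => e; rewrite [in RHS]inE.
Qed.

Lemma embedding_edge_ends (e : edge H) : e \in EL ->
  #|ends H e| = (if dangling H e then 1 else 2)%N.
Proof.
move=> /embedding_edge_cases[[j ->]|[f ->]].
  by rewrite combined_ends_sk cards2 /= codom_f andbF.
by rewrite /= card_imset ?enet_graph //; apply: inr_inj.
Qed.

Lemma out_edges_disjoint x y : x != y -> [disjoint out_edges x & out_edges y].
Proof.
move=> xy; apply/pred0P => e /=; apply/negbTE/negP => /andP[].
move=> /out_edgesP[eE xe hx] /out_edgesP[_ ye hy].
have sxy : [set x; y] \subset ends H e.
  by apply/subsetP => z; rewrite !inE => /orP[] /eqP->.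
have ce := embedding_edge_ends eE.
have := subset_leq_card sxy; rewrite ce cards2 xy.
case: hx hy => [-> //|[z ze xz]]; case: (dangling H e) ce => // ce.
case=> [//|[t te yt]] _.
have /eqP eE' : [set x; y] == ends H e by rewrite eqEcard sxy ce cards2 xy.
move: ze te; rewrite -eE' !inE => /orP[] /eqP ez /orP[] /eqP et; subst z t.
- by rewrite ltnn in xz.
- by rewrite ltnn in xz.
- by have := ltn_trans xz yt; rewrite ltnn.
- by rewrite ltnn in yt.
Qed.

Hypothesis order : sketch_order rk.

Lemma sketched_low x y : x \in sketched_vertices -> y \in active_vertices ->
  y \notin sketched_vertices -> (rk x < rk y)%N.
Proof.
move=> /imsetP[j _ ->]; case: y => [v|z _ _]; last exact: order.2.
rewrite inE => /codomP[i ->]; move/negP; case; exact: imset_f.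
Qed.

Lemma sketched_edge_out j : inl (sk j) \in out_edges (inl (skv j)).
Proof.
rewrite inE inE codom_f combined_ends_sk !inE eqxx /=; apply/orP; right.
by apply/exists_inP; exists (inr (attach G j)); rewrite ?inE ?eqxx ?orbT //; apply: order.2.
Qed.

Lemma sketched_out x e : x \in sketched_vertices -> e \in out_edges x ->
  exists2 y, y \in ends H e & y \notin sketched_vertices.
Proof.
move=> /imsetP[j _ ->] /out_edgesP[/embedding_edge_cases[[i ->]|[f ->]] xe _].
  exists (inr (attach G i)); first by rewrite combined_ends_sk !inE eqxx orbT.
  by apply/imsetP => -[].
by move: xe => /imsetP[].
Qed.

Variable lam : R.
Hypothesis lam_dim : forall j, lam <= weight (dnet D) (sk j).
Hypothesis lam_out : forall z, lam <= out_cut rk (inr z).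

Lemma out_edges_weight x : x \in active_vertices -> lam <= total_weight (weight H) (out_edges x).
Proof.
case: x => [v|z _]; last by rewrite -out_cutE.
rewrite inE => /codomP[j ->]; apply: le_trans (lam_dim j) _.
rewrite /total_weight (bigD1 (inl (sk j))) ?sketched_edge_out //= lerDl.
by apply: sumr_ge0 => e _; apply: combined_weight_ge0.
Qed.

Lemma active_not_sketched : exists2 z, z \in active_vertices & z \notin sketched_vertices.
Proof.
exists (inr (attach G (Ordinal (nsk_gt0 D)))); first by rewrite inE.
by apply/imsetP => -[].
Qed.

Lemma embedding_dangling_unique :
  #|[set f | dangling (enet G) f]| = 1%N ->
  forall e e', e \in EL -> e' \in EL -> dangling H e -> dangling H e' -> e = e'.
Proof.
move=> /eqP/cards1P[f0 ef0].
have h e : e \in EL -> dangling H e -> e = inr f0.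
  move=> /embedding_edge_cases[[j ->]|[f ->]] /=; first by rewrite codom_f andbF.
  move=> df; have : f \in [set f | dangling (enet G) f] by rewrite inE.
  by rewrite ef0 inE => /eqP->.
by move=> e e' eE e'E de de'; rewrite (h e) // (h e').
Qed.

Lemma data_partC A : data_part (~: A) = ~: data_part A.
Proof. by apply/setP => v; rewrite !inE. Qed.

Lemma data_part_disjoint A B : [disjoint A & B] ->
  [disjoint data_part A & data_part B].
Proof.
move=> dAB; apply/pred0P => v /=; rewrite !inE.
case vA: (_ \in A) => //=; exact: disjointFr dAB vA.
Qed.

Lemma data_partU A B : data_part (A :|: B) = data_part A :|: data_part B.
Proof. by apply/setP => v; rewrite !inE. Qed.

Lemma touches_data (f : edge (dnet D)) A : f \notin codom (@sk R D) ->
  @touches _ _ H (inl f) A = touches f (data_part A).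
Proof.
move=> fsk; apply/touchesP/touchesP => [[x]|[v vf]]; last first.
  by rewrite inE => vA; exists (inl v) => //; rewrite inE imset_f.
rewrite inE => /orP[/imsetP[v vf ->] vA|/imsetP[j]].
  by exists v; rewrite ?inE.
by rewrite inE => /eqP ef; move: fsk; rewrite -ef codom_f.
Qed.

(** Data edges other than the sketched ones only see the data vertices. *)
Lemma combined_costE A B : [disjoint A & B] ->
  cost H A B = cost (netR D) (data_part A) (data_part B) + flow_cost EL A B.
Proof.
move=> dAB.
rewrite (costE combined_ends_neq0 dAB) (costE (@netR_ends_neq0 _ D) (data_part_disjoint dAB)).
rewrite (bigID (fun e => e \in EL)) /= addrC; congr (_ + _); last first.
  by rewrite /flow_cost /total_weight; apply: eq_bigl => e; rewrite !inE -andb_orr andbC.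
rewrite big_sumType /= [X in _ + X]big1 ?addr0; last by move=> f; rewrite inE andbF.
rewrite -(big_sub_cond [set e : edge (dnet D) | e \notin codom (@sk R D)]
  (fun f : edge (dnet D) => exits f (data_part A) || exits f (data_part B))
  (fun f => weight (dnet D) f)).
apply: eq_bigl => f; rewrite !inE andbC.
case: (boolP (f \in codom _)) => //= fsk.
by rewrite /exits !touches_data // !data_partC /= fsk andbT.
Qed.

Lemma flow_cost_ge0 A B : 0 <= flow_cost EL A B.
Proof. by apply: total_weight_ge0; apply: combined_weight_ge0. Qed.

(** Embedding edges only end at active vertices. *)
Lemma flow_cost_act A B :
  flow_cost EL (A :&: active_vertices) (B :&: active_vertices) = flow_cost EL A B.
Proof.
have h X : exit_set EL (X :&: active_vertices) = exit_set EL X.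
  apply: eq_finset => e /=; case: (boolP (e \in EL)) => //= eE.
  have /subsetP sub := embedding_ends_active eE.
  rewrite /exits /=; congr (_ && (_ || _)).
    apply/touchesP/touchesP => [[x xe]|[x xe xX]].
      by rewrite inE => /andP[? _]; exists x.
    by exists x; rewrite // inE xX sub.
  apply/touchesP/touchesP => -[x xe h]; exists x => //; move: h;
    by rewrite !finset.in_setC finset.in_setI (sub _ xe) andbT.
by rewrite /flow_cost !h.
Qed.

End Combined.

(** * Lower bounds for constrained trees *)

Section Sketched.
Context {R : realType} {D : data R}.
Implicit Types (T : ctree (dvertex D)) (A B W : {set dvertex D}) (j : 'I_(nsk D)).

Lemma sk_inU A B : sk_in (A :|: B) = sk_in A :|: sk_in B.
Proof. by apply/setP => j; rewrite !inE. Qed.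

Lemma sk_inS A B : A \subset B -> sk_in A \subset sk_in B.
Proof. by move=> /subsetP AB; apply/subsetP => j; rewrite !inE => /AB. Qed.

Lemma in_sk_in A j : (j \in sk_in A) = (skv j \in A).
Proof. by rewrite inE. Qed.

(** The contraction at which the sketched edge [j] first meets another one, with
[W] the result of the contractions of D(e_j), or the leaf [skv j]. *)
Lemma isolated_until T j : skv j \in leaf_set T -> sk_in (leaf_set T) != [set j] ->
  exists p W B, [/\ p \in contractions T, sides p W B,
    sk_in W = [set j] & sk_in B != finset.set0].
Proof.
have extend T1 T2 : {subset contractions T1 <= contractions T2} ->
  (exists p W B, [/\ p \in contractions T1, sides p W B,
    sk_in W = [set j] & sk_in B != finset.set0]) ->
  (exists p W B, [/\ p \in contractions T2, sides p W B,
    sk_in W = [set j] & sk_in B != finset.set0]).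
  by move=> s [p [W [B [/s pT ? ? ?]]]]; exists p, W, B.
elim: T => [v|l IHl r IHr].
  rewrite leaf_set_Leaf inE => /eqP <- /eqP; case; apply/setP => i.
  by rewrite !inE (inj_eq (@skv_inj _ D)).
rewrite leaf_set_Node sk_inU inE => /orP[jl|jr] ne.
  have [el|nl] := eqVneq (sk_in (leaf_set l)) [set j].
    exists (leaf_set l, leaf_set r), (leaf_set l), (leaf_set r); split=> //.
    - by rewrite /= mem_head.
    - by left.
    - by apply: contraNneq ne => ->; rewrite finset.setU0 el.
  apply: extend (IHl jl nl) => p pl.
  by rewrite /= inE mem_cat pl orbT.
have [er|nr] := eqVneq (sk_in (leaf_set r)) [set j].
  exists (leaf_set l, leaf_set r), (leaf_set r), (leaf_set l); split=> //.
  - by rewrite /= mem_head.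
  - by right.
  - by apply: contraNneq ne => ->; rewrite finset.set0U er.
apply: extend (IHr jr nr) => p pr.
by rewrite /= inE mem_cat pr !orbT.
Qed.

End Sketched.

Section LowerBounds.
Context {R : realType} {D : data R} (G : embedding D).
Notation H := (combined G).
Notation EL := (embedding_edges G).
Variables (T0 : ctree (dvertex D)) (TB : ctree (dvertex D + evertex G)%type).
Hypotheses (T0_tree : contraction_tree T0) (TB_tree : contraction_tree TB).
Hypothesis TB_T0 : constrained TB T0.
Variables (rk : dvertex D + evertex G -> nat) (lam : R).
Hypothesis order : sketch_order rk.
Hypothesis lam_dim : forall j, lam <= weight (dnet D) (sk j).
Hypothesis lam_out : forall z, lam <= out_cut rk (inr z).
Implicit Types (p : {set dvertex D} * {set dvertex D}) (j : 'I_(nsk D)).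
Implicit Types (q : {set dvertex D + evertex G} * {set dvertex D + evertex G}).
Implicit Types (X Y : {set dvertex D + evertex G}).

Let uT0 : uniq (leaves T0) := contraction_tree_uniq T0_tree.
Let uTB : uniq (leaves TB) := contraction_tree_uniq TB_tree.

Definition step_cost q : R := expR (cost H q.1 q.2).

(** The two sides of a contraction come in no particular order. *)
Definition realizes p q : bool :=
  (p == (data_part q.1, data_part q.2)) || (p == (data_part q.2, data_part q.1)).

Definition realized_cost p : R := \sum_(q <- contractions TB | realizes p q) step_cost q.

Lemma step_cost_ge0 q : 0 <= step_cost q. Proof. exact: expR_ge0. Qed.

Lemma step_cost_sides q X Y : sides q X Y -> step_cost q = expR (cost H X Y).
Proof. by case=> ->; rewrite /step_cost //= costC. Qed.

Lemma exists_realizing p : p \in contractions T0 ->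
  exists2 q, q \in contractions TB & realizes p q.
Proof.
case: p => A B /TB_T0[A' [B' [[h|h] eA eB]]]; rewrite -eA -eB.
  by exists (A', B'); rewrite ?/realizes /= ?eqxx.
by exists (B', A'); rewrite ?/realizes /= ?eqxx ?orbT.
Qed.

Lemma realizes_sides p q W B : realizes p q -> sides p W B ->
  exists X Y, [/\ sides q X Y, data_part X = W & data_part Y = B].
Proof.
case: q => X Y; rewrite /realizes /sides /= => /orP[] /eqP -> [] [] <- <-.
- by exists X, Y; split=> //; left.
- by exists Y, X; split=> //; right.
- by exists Y, X; split=> //; right.
- by exists X, Y; split=> //; left.
Qed.

Lemma realized_cost_ge p (c : R) : p \in contractions T0 ->
  (forall q, q \in contractions TB -> realizes p q -> c <= step_cost q) ->
  c <= realized_cost p.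
Proof.
move=> /exists_realizing[q qT pq] h; apply: le_trans (h q qT pq) _.
rewrite /realized_cost (big_rem q qT) /= pq lerDl.
by apply: sumr_ge0 => *; apply: step_cost_ge0.
Qed.

Lemma realized_cost_ge0 p : 0 <= realized_cost p.
Proof. by apply: sumr_ge0 => *; apply: step_cost_ge0. Qed.

Lemma sum_realized_cost :
  \sum_(p <- contractions T0) realized_cost p <= 2 * tree_cost H TB.
Proof.
apply: double_counting => [q|q]; first exact: step_cost_ge0.
have one x : (count (pred1 x) (contractions T0) <= 1)%N.
  by rewrite count_uniq_mem ?contractions_uniq //; case: (x \in _).
rewrite /realizes (leq_trans _ (leq_add (one (data_part q.1, data_part q.2))
  (one (data_part q.2, data_part q.1)))) //.
rewrite -[leqRHS]count_predUI; apply: leq_trans (leq_addr _ _).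
by apply: sub_count.
Qed.

Lemma active_data A : sk_in (data_part A) != finset.set0 -> active (active_vertices G) A.
Proof.
move=> /set0Pn[j]; rewrite !inE => jA; exists (inl (skv j)) => //.
by rewrite inE codom_f.
Qed.

Let flow_ge1 := flow_cost_ge1 (@combined_weight_ge0 _ _ G) (@embedding_ends_active _ _ G)
  (@out_edgesP _ _ G rk) (out_edges_weight order lam_dim lam_out).
Let flow_ge2 := flow_cost_ge2 (@combined_weight_ge0 _ _ G) (@embedding_ends_active _ _ G)
  (@out_edgesP _ _ G rk) (@out_edges_disjoint _ _ G rk) (out_edges_weight order lam_dim lam_out).

Lemma step_costE q X Y : q \in contractions TB -> sides q X Y ->
  step_cost q = expR (cost (netR D) (data_part X) (data_part Y)) * expR (flow_cost EL X Y).
Proof.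
move=> qT qXY; rewrite (step_cost_sides qXY) -expRD combined_costE //.
by have [] := sides_contraction uTB qT qXY.
Qed.

Lemma realizing_step_cost p q : q \in contractions TB -> realizes p q ->
  exists X Y, [/\ sides q X Y, data_part X = p.1, data_part Y = p.2, [disjoint X & Y] &
    step_cost q = expR (cost (netR D) p.1 p.2) * expR (flow_cost EL X Y)].
Proof.
move=> qT pq; have [|X [Y [qXY eX eY]]] := realizes_sides (W := p.1) (B := p.2) pq.
  by left; case: p pq.
exists X, Y; split=> //; last by rewrite (step_costE qT qXY) eX eY.
by have [] := sides_contraction uTB qT qXY.
Qed.

Lemma realized_cost_ge_data p : p \in contractions T0 ->
  expR (cost (netR D) p.1 p.2) <= realized_cost p.
Proof.
move=> pT; apply: realized_cost_ge => // q qT pq.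
have [X [Y [_ _ _ _ ->]]] := realizing_step_cost qT pq.
rewrite ler_peMr ?expR_ge0 // -[leLHS]expR0 ler_expR.
exact: flow_cost_ge0.
Qed.

Lemma realized_cost_ge_sketched p : p \in contractions T0 ->
  sk_in (p.1 :|: p.2) != finset.set0 ->
  expR (cost (netR D) p.1 p.2) * expR lam <= realized_cost p.
Proof.
move=> pT sk0; apply: realized_cost_ge => // q qT pq.
have [X [Y [_ eX eY _ ->]]] := realizing_step_cost qT pq.
rewrite ler_wpM2l ?expR_ge0 // ler_expR.
have : (sk_in p.1 != finset.set0) || (sk_in p.2 != finset.set0).
  apply: contraR sk0; rewrite negb_or !negbK sk_inU => /andP[/eqP-> /eqP->].
  by rewrite finset.setU0.
case/orP; rewrite -?eX -?eY => /active_data a; first exact: flow_ge1 a.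
by rewrite flow_costC; apply: flow_ge1 a.
Qed.

Lemma realized_cost_ge_merge p : p \in contractions T0 -> in_S p ->
  expR (cost (netR D) p.1 p.2) * (expR lam * expR lam) <= realized_cost p.
Proof.
move=> pT /andP[]; rewrite !card_gt0 => s1 s2; apply: realized_cost_ge => // q qT pq.
have [X [Y [_ eX eY dXY ->]]] := realizing_step_cost qT pq.
rewrite ler_wpM2l ?expR_ge0 // -expRD ler_expR.
by apply: flow_ge2 => //; apply: active_data; rewrite ?eX ?eY.
Qed.

Lemma sk_edge_flow j X Y : inl (skv j) \in X -> inr (attach G j) \notin X ->
  weight (dnet D) (sk j) <= flow_cost EL X Y.
Proof.
move=> xX yX; have -> : weight (dnet D) (sk j) = total_weight (weight H) [set inl (sk j)].
  by rewrite /total_weight finset.big_set1.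
apply: total_weightS; first exact: combined_weight_ge0.
apply/subsetP => e /finset.set1P ->; rewrite !inE codom_f /=; apply/orP; left.
apply/andP; split; [|apply/orP; left]; apply/touchesP.
  by exists (inl (skv j)); rewrite ?combined_ends_sk ?inE ?eqxx.
by exists (inr (attach G j)); rewrite ?combined_ends_sk ?inE ?eqxx ?orbT.
Qed.

Lemma sk_edge_flow_active j X Y : [disjoint X & Y] -> active (active_vertices G) Y ->
  inl (skv j) \in X -> inr (attach G j) \notin X ->
  weight (dnet D) (sk j) + lam <= flow_cost EL X Y.
Proof.
move=> dXY /(exists_top rk)[y ty] xX yX; have [yY ya _] := ty.
have -> : weight (dnet D) (sk j) = total_weight (weight H) [set inl (sk j)].
  by rewrite /total_weight finset.big_set1.
apply: le_trans (lerD (lexx _) (out_edges_weight order lam_dim lam_out ya)) _.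
apply: (total_weight2_le (@combined_weight_ge0 _ _ G)).
- rewrite disjoints_subset sub1set inE.
  have := out_disjointP (@out_edges_disjoint _ _ G rk) dXY xX yY.
  by move=> /disjointFr -> //; apply: sketched_edge_out.
- apply/subsetP => e /finset.set1P ->; rewrite !inE codom_f /=; apply/orP; left.
  apply/andP; split; [|apply/orP; left]; apply/touchesP.
    by exists (inl (skv j)); rewrite ?combined_ends_sk ?inE ?eqxx.
  by exists (inr (attach G j)); rewrite ?combined_ends_sk ?inE ?eqxx ?orbT.
- apply: subset_trans (top_out (@embedding_ends_active _ _ G) (@out_edgesP _ _ G rk) ty) _.
  exact: finset.subsetUr.
Qed.

Lemma attaching_contraction j : exists q X Y,
  [/\ q \in contractions TB, sides q X Y, inl (skv j) \in X & inr (attach G j) \in Y].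
Proof.
have [||q [qT _ [a aS a1] [b bS b2]]] :=
    @contraction_splitting _ TB [set inl (skv j); inr (attach G j)].
- by rewrite (contraction_tree_leaf_set TB_tree) finset.subsetT.
- by rewrite cards2.
have d := contraction_disjoint uTB qT.
have ab : a != b by apply: contraTneq b2 => <-; rewrite (disjointFr d a1).
exists q; move: aS bS ab; rewrite !inE => /orP[] /eqP ea /orP[] /eqP eb; subst a b;
  rewrite ?eqxx // => _.
  by exists q.1, q.2; split=> //; left; case: (q).
by exists q.2, q.1; split=> //; right; case: (q).
Qed.

(** The least common ancestor in [T0] of the data vertices of [X] is realized in
[TB] by a contraction both of whose sides meet [X], hence contained in [X]. *)
Lemma data_part_node X : side TB X -> (1 < #|data_part X|)%N ->
  exists2 p, p \in contractions T0 & data_part X = p.1 :|: p.2.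
Proof.
move=> sX cX.
have [|p [pT sp [a aX a1] [b bX b2]]] := contraction_splitting (T := T0) _ cX.
  by rewrite (contraction_tree_leaf_set T0_tree) finset.subsetT.
exists p => //; apply/eqP; rewrite eqEsubset sp /=.
have [q qT pq] := exists_realizing pT.
have [X' [Y' [qXY eX eY dXY _]]] := realizing_step_cost qT pq.
have [_ _ _ eU] := sides_contraction uTB qT qXY.
have aX' : inl a \in X' by move: a1; rewrite -eX inE.
have bY' : inl b \in Y' by move: b2; rewrite -eY inE.
move: aX bX; rewrite !inE => aX bX.
have : q.1 :|: q.2 \subset X.
  by apply: side_meets_both uTB sX qT _ _;
    case: qXY => -> /=; [exists (inl a) | exists (inl b) | exists (inl b) | exists (inl a)].
rewrite eU => /subsetP s; rewrite -eX -eY -data_partU.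
by apply/subsetP => v; rewrite !inE => vU; apply: s; rewrite inE.
Qed.

Lemma data_partS X Y : X \subset Y -> data_part X \subset data_part Y.
Proof. by move=> /subsetP s; apply/subsetP => v; rewrite !inE => /s. Qed.

(** [W] is the tensor to which the matrix of e_j should be applied.  Let [X0] be
the node of [TB] containing v_j just before v_j meets the embedding vertex attached
to e_j.  If the data part of [X0] holds no other sketched edge, [W] is this data
part; otherwise e_j survives all of D(e_j) and [W] is the result of D(e_j).  The
condition on [q] determines [j] up to two choices. *)
Lemma sketch_edge_charge j : exists W q,
  [/\ W = [set skv j] \/ (exists2 p, p \in contractions T0 & in_D j p /\ W = p.1 :|: p.2),
      q \in contractions TB,
      (sk_in (data_part q.1) == [set j]) || (sk_in (data_part q.2) == [set j]),
      expR (net_cut (netR D) W) * dim_size j * expR lam <= step_cost q &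
      forall p, p \in contractions T0 -> in_D j p -> p.1 :|: p.2 \subset W ->
        expR (cost (netR D) p.1 p.2) * dim_size j <= realized_cost p].
Proof.
have [q0 [X0 [Y0 [q0T q0XY xX0 yY0]]]] := attaching_contraction j.
have [sX0 sY0 dXY0 _] := sides_contraction uTB q0T q0XY.
have yX0 : inr (attach G j) \notin X0 by rewrite (disjointFl dXY0 yY0).
have jX0 : j \in sk_in (data_part X0) by rewrite !inE.
have below X : side TB X -> inl (skv j) \in X -> ~~ (X0 \subset X) ->
    inr (attach G j) \notin X.
  move=> sX xX nX; case: (side_comparable uTB sX0 sX) => [d|h|/subsetP s].
  - by move: (disjointFr d xX0); rewrite xX.
  - by rewrite h in nX.
  - by apply: contra yX0; apply: s.
have only_j (S : {set 'I_(nsk D)}) : j \in S -> S \subset [set j] -> S = [set j].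
  by move=> jS sS; apply/eqP; rewrite eqEsubset sS sub1set.
(* Below the node of TB where v_j meets its embedding vertex, e_j is still cut. *)
have early p : p \in contractions T0 -> in_D j p ->
    (sk_in (data_part X0) = [set j] -> p.1 :|: p.2 \subset data_part X0) ->
    expR (cost (netR D) p.1 p.2) * dim_size j <= realized_cost p.
  move=> pT /eqP pD pX0; apply: realized_cost_ge => // q qT pq.
  have [W [B [pWB jW]]] : exists W B, sides p W B /\ skv j \in W.
    have : j \in sk_in (p.1 :|: p.2) by rewrite pD inE.
    rewrite sk_inU !inE => /orP[jp|jp]; first by exists p.1, p.2; split=> //; left; case: (p).
    by exists p.2, p.1; split=> //; right; case: (p).
  have [_ _ dWB eWB] := sides_contraction uT0 pT pWB.
  have [X [Y [qXY eX eY]]] := realizes_sides pq pWB.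
  have [sX sY dXY _] := sides_contraction uTB qT qXY.
  have xX : inl (skv j) \in X by move: jW; rewrite -eX inE.
  have nX : ~~ (X0 \subset X).
    apply/negP => /data_partS; rewrite eX => sW.
    have sk1 : sk_in (data_part X0) = [set j].
      apply: only_j => //; rewrite -pD eWB sk_inU.
      exact: subset_trans (sk_inS sW) (finset.subsetUl _ _).
    have := pX0 sk1; rewrite eWB subUset => /andP[_ /subset_trans /(_ sW) sBW].
    have [b bB] : exists b, b \in B.
      have [[a1 h1] [a2 h2]] := contraction_side_neq0 pT.
      by case: pWB h1 h2 => -> /= h1 h2; [exists a2 | exists a1].
    by move: (disjointFl dWB bB); rewrite (subsetP sBW _ bB).
  rewrite (step_costE qT qXY) eX eY.
  have -> : cost (netR D) p.1 p.2 = cost (netR D) W B.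
    by case: pWB => -> //=; rewrite costC.
  rewrite ler_wpM2l ?expR_ge0 // ler_expR; apply: sk_edge_flow => //.
  exact: below.
have main W X Y q : data_part X = W -> q \in contractions TB ->
    sides q X Y -> inl (skv j) \in X -> inr (attach G j) \notin X ->
    active (active_vertices G) Y ->
    expR (net_cut (netR D) W) * dim_size j * expR lam <= step_cost q.
  move=> <- qT qXY xX yX aY; have [_ _ dXY _] := sides_contraction uTB qT qXY.
  rewrite (step_costE qT qXY) -mulrA ler_pM ?expR_ge0 ?mulr_ge0 ?expR_ge0 //.
    rewrite ler_expR; apply: net_cut_le_costl.
    - exact: netR_ends_neq0.
    - exact: netR_weight_ge0.
    - exact: data_part_disjoint.
  by rewrite -expRD ler_expR; apply: sk_edge_flow_active.
have single q W X Y : sides q X Y -> data_part X = W -> sk_in W = [set j] ->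
    (sk_in (data_part q.1) == [set j]) || (sk_in (data_part q.2) == [set j]).
  by case=> -> /= -> ->; rewrite eqxx ?orbT.
have [sk1|skn] := eqVneq (sk_in (data_part X0)) [set j].
  exists (data_part X0), q0; split=> //.
  - case: (leqP #|data_part X0| 1) => [c1|c2].
      left; apply/eqP; rewrite eq_sym eqEcard sub1set cards1 c1 andbT.
      by move: jX0; rewrite inE.
    have [p pT eW] := data_part_node sX0 c2.
    by right; exists p => //; split=> //; rewrite /in_D -eW sk1.
  - exact: single q0XY erefl sk1.
  - apply: main q0XY _ _ _ => //; exists (inr (attach G j)) => //; rewrite inE //.
  - by move=> p pT pD pW; apply: early.
have [||p [W [B [pT pWB skW skB]]]] := @isolated_until _ _ T0 j.
- by rewrite (contraction_tree_leaf_set T0_tree) inE.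
- apply: contra skn => /eqP h; apply/eqP/only_j => //; rewrite -h.
  by rewrite (contraction_tree_leaf_set T0_tree) sk_inS // finset.subsetT.
have [q qT pq] := exists_realizing pT.
have [X [Y [qXY eX eY]]] := realizes_sides pq pWB.
have [sX sY dXY _] := sides_contraction uTB qT qXY.
have jW : skv j \in W by rewrite -in_sk_in skW inE.
have xX : inl (skv j) \in X by move: jW; rewrite -eX inE.
exists W, q; split=> //.
- have WB : W = p.1 \/ W = p.2 by case: pWB => ->; [left | right].
  case: (contraction_side_cases pT WB) => [[v eW]|[p' p'T eW]].
    by left; move: jW; rewrite eW inE => /eqP->.
  by right; exists p' => //; split=> //; rewrite /in_D -eW skW.
- exact: single qXY eX skW.
- apply: (main _ _ _ _ eX qT qXY xX); last by apply: active_data; rewrite eY.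
  apply: below => //; apply/negP => /data_partS; rewrite eX => /sk_inS.
  by rewrite skW => /(only_j _ jX0) h; rewrite h eqxx in skn.
- by move=> p' p'T p'D _; apply: early => // h; rewrite h eqxx in skn.
Qed.

End LowerBounds.

(** * The contraction of two sketched tensors *)

Section SketchNet.
Context {R : realType}.
Variables a b c d m al : R.
Hypotheses (a0 : 0 < a) (b0 : 0 < b) (c0 : 0 < c) (d0 : 0 < d) (m0 : 0 < m) (al0 : 0 < al).
Notation N := (sketch_net a b c d m al).

Lemma ord4_cases (x : 'I_4) : [\/ x = tU, x = tV, x = tz1 | x = tz2].
Proof.
by case: x => [[|[|[|[|//]]]] i]; [apply: Or41|apply: Or42|apply: Or43|apply: Or44];
  apply: val_inj.
Qed.

Lemma touches4 (H : network R 'I_4) (e : edge H) (A : {set 'I_4}) :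
  touches e A = [|| (tU \in ends H e) && (tU \in A), (tV \in ends H e) && (tV \in A),
    (tz1 \in ends H e) && (tz1 \in A) | (tz2 \in ends H e) && (tz2 \in A)].
Proof.
apply/touchesP/or4P => [[x xe xA]|[] /andP[? ?]].
- by case: (ord4_cases x) => ex; subst x;
    [apply: Or41|apply: Or42|apply: Or43|apply: Or44]; rewrite xe.
- by exists tU.
- by exists tV.
- by exists tz1.
- by exists tz2.
Qed.

Lemma sketch_net_ends_neq0 (e : edge N) : ends N e != finset.set0.
Proof.
apply/set0Pn; case: e => [[|[|[|[|[|[|[|[|[|//]]]]]]]]] i] /=;
  rewrite /tnth /=;
  first [by exists tU; rewrite !inE | by exists tV; rewrite !inE | by exists tz1; rewrite !inE
    | by exists tz2; rewrite !inE].
Qed.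

(** The summands are the contractions with [z1], with the second tensor and with
[z2], in this order. *)
Lemma sketch_tree_cost : tree_cost N sketch_tree =
  a * b * d * m * al * m + a * b * c * d * m * m + a * c * d * m * (m / al) * m.
Proof.
have mal : 0 < m / al by rewrite divr_gt0.
rewrite /tree_cost /= !big_cons big_nil addr0 /=.
have c1 : cost N (leaf_set (Leaf tU)) (leaf_set (Leaf tz1)) =
    ln a + ln b + ln d + ln m + ln al + ln m.
  rewrite (costE sketch_net_ends_neq0) ?leaf_set_disjoint //.
  rewrite big_mkcond /= !big_ord_recl big_ord0 /exits !touches4.
  rewrite !leaf_set_Leaf /tnth /=. rewrite !inE /=. ring.
have c2 : cost N (leaf_set (Node (Leaf tU) (Leaf tz1))) (leaf_set (Leaf tV)) =
    ln a + ln b + ln c + ln d + ln al + ln m + ln (m / al).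
  rewrite (costE sketch_net_ends_neq0) ?leaf_set_disjoint //.
  rewrite big_mkcond /= !big_ord_recl big_ord0 /exits !touches4.
  rewrite !leaf_set_Node !leaf_set_Leaf /tnth /=. rewrite !inE /=. ring.
have c3 : cost N (leaf_set (Node (Node (Leaf tU) (Leaf tz1)) (Leaf tV)))
    (leaf_set (Leaf tz2)) =
    ln a + ln c + ln d + ln m + ln (m / al) + ln m.
  rewrite (costE sketch_net_ends_neq0) ?leaf_set_disjoint //.
  rewrite big_mkcond /= !big_ord_recl big_ord0 /exits !touches4.
  rewrite !leaf_set_Node !leaf_set_Leaf /tnth /=. rewrite !inE /=. ring.
rewrite c1 c2 c3 !expRD !lnK ?posrE //.
by field; exact: lt0r_neq0.
Qed.

End SketchNet.

(** With [s = sqrt (c m / b)] one has [c m = b s^2], so the terms [b alpha] and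
[c m / alpha] are both [b s] at [alpha = s].  When [s] is truncated to [m] or to [1],
one of them is still at most [b s] and the other at most [b c]. *)
Lemma sketched_cost_le {R : realType} (a b c d m : R) :
  0 < a -> 1 <= b -> 1 <= c -> 0 < d -> 1 <= m ->
  sketched_cost a b c d m <=
    2 * (a * d * m ^+ 2) * (b * c + Num.sqrt (b * c * m)).
Proof.
move=> a0 b1 c1 d0 m1.
have b0 : 0 < b by apply: lt_le_trans b1.
have c0 : 0 < c by apply: lt_le_trans c1.
have m0 : 0 < m by apply: lt_le_trans m1.
pose s := Num.sqrt (c * m / b).
have s0 : 0 < s by rewrite sqrtr_gt0 divr_gt0 ?mulr_gt0.
have ss : b * s * s = c * m.
  by rewrite -mulrA -expr2 sqr_sqrtr ?divr_ge0 ?mulr_ge0 ?ltW // mulrC divfK ?gt_eqF.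
have -> : Num.sqrt (b * c * m) = b * s.
  have -> : b * c * m = (b * s) ^+ 2 by rewrite expr2 mulrCA -mulrA mulrCA -ss; ring.
  by rewrite sqrtr_sqr ger0_norm // mulr_ge0 ?ltW.
rewrite /sketched_cost; set al := alpha b c m.
have al0 : 0 < al by rewrite /al /alpha lt_max ltr01.
rewrite sketch_tree_cost //.
have -> : a * b * d * m * al * m + a * b * c * d * m * m + a * c * d * m * (m / al) * m
    = (a * d * m ^+ 2) * (b * al + b * c + c * m / al) by field; exact: lt0r_neq0.
have adm0 : 0 <= a * d * m ^+ 2 by rewrite ltW // !mulr_gt0 ?exprn_gt0.
rewrite [2 * _]mulrC -[leRHS]mulrA ler_wpM2l //.
have [b0' c0'] := (ltW b0, ltW c0).
have bc : b <= b * c by rewrite ler_peMr.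
have cb : c <= b * c by rewrite ler_peMl.
have bs0 : 0 <= b * s by rewrite mulr_ge0 ?ltW.
rewrite /al /alpha -/s /Num.max /Num.min.
case: (ltP m s) => ms.
  have -> : (if 1 < m then m else 1) = m.
    by case: ltP => // m1'; apply: le_anti; rewrite m1 m1'.
  have -> : c * m / m = c by rewrite mulfK ?gt_eqF.
  (* [s] is truncated to [m] *)
  have : b * m <= b * s by rewrite ler_wpM2l // ltW.
  lra.
case: (ltP 1 s) => s1.
  have -> : c * m / s = b * s by rewrite -ss mulfK ?gt_eqF.
  lra.
rewrite mulr1 divr1 -ss.
have : b * s * s <= b * s by rewrite ler_piMr.
lra.
Qed.

Lemma sketched_cost_le_sqrt {R : realType} (a b c d m : R) :
  0 < a -> 1 <= b -> 1 <= c -> 0 < d -> 1 <= m ->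
  sketched_cost a b c d m <= 4 * Num.sqrt m * (a * b * c * d * m ^+ 2).
Proof.
move=> a0 b1 c1 d0 m1; apply: le_trans (sketched_cost_le a0 b1 c1 d0 m1) _.
have m0 : 0 <= m by apply: le_trans m1.
have bc1 : 1 <= b * c by rewrite mulr_ege1.
have bc0 : 0 <= b * c by apply: le_trans bc1.
have sm1 : 1 <= Num.sqrt m by rewrite -sqrtr1 ler_sqrt // (lt_le_trans ltr01).
have sbc : Num.sqrt (b * c) <= b * c.
  rewrite -{2}(sqr_sqrtr bc0) expr2 ler_peMr ?sqrtr_ge0 //.
  by rewrite -{1}sqrtr1 ler_sqrt // (lt_le_trans ltr01).
have -> : 4 * Num.sqrt m * (a * b * c * d * m ^+ 2) =
  2 * (a * d * m ^+ 2) * (2 * (b * c * Num.sqrt m)) by ring.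
have adm0 : 0 <= 2 * (a * d * m ^+ 2).
  by rewrite ltW // !mulr_gt0 ?exprn_gt0 // (lt_le_trans ltr01).
rewrite ler_wpM2l //.
rewrite sqrtrM // mulr2n mulrDl !mul1r lerD //.
  by rewrite ler_peMr.
by rewrite ler_wpM2r ?sqrtr_ge0.
Qed.

Lemma powR_eighth {R : realType} (m : R) : 1 <= m ->
  exists r : R, [/\ 1 <= r, m `^ (3 / 8) = r ^+ 3 & Num.sqrt m = r ^+ 4].
Proof.
move=> m1; have m0 : 0 <= m by apply: le_trans m1.
exists (m `^ 8^-1); have mp n : (m `^ 8^-1) ^+ n = m `^ (n%:R / 8).
  by rewrite -powR_mulrn ?powR_ge0 // -powRrM [_ * n%:R]mulrC.
split.
- by rewrite -[leLHS](powRr0 m) ler_powR // invr_ge0.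
- by rewrite mp.
- have e : m = (m `^ (4%:R / 8)) ^+ 2.
    rewrite -powR_mulrn ?powR_ge0 // -powRrM (_ : 4%:R / 8 * 2%:R = 1) ?powRr1 //.
    by field.
  by rewrite mp [in LHS]e sqrtr_sqr ger0_norm ?powR_ge0.
Qed.

(** Writing [m = r^8], the cases [sqrt (b c) <= r] and [sqrt (b c) > r] are balanced:
in the first [a d sqrt (b c) <= c r <= r^3], in the second
[sqrt (b c) <= b c / r], which saves a factor [r] out of [sqrt m = r^4]. *)
Lemma sketched_cost_le_graph {R : realType} (a b c d m : R) :
  0 < a -> 1 <= b -> 1 <= c -> 0 < d -> 1 <= m -> d <= 1 -> a <= c ->
  sketched_cost a b c d m <=
    m `^ (3 / 8) * (4 * (a * b * c * d * m ^+ 2) + 2 * (m ^+ 2 * Num.sqrt m)).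
Proof.
move=> a0 b1 c1 d0 m1 d1 ac; apply: le_trans (sketched_cost_le a0 b1 c1 d0 m1) _.
have [r [r1 -> smr]] := powR_eighth m1.
have m0 : 0 <= m by apply: le_trans m1.
have r0 : 0 <= r by apply: le_trans r1.
have bc1 : 1 <= b * c by rewrite mulr_ege1.
have bc0 : 0 <= b * c by apply: le_trans bc1.
rewrite sqrtrM // smr.
set t := Num.sqrt (b * c).
have t0 : 0 <= t by apply: sqrtr_ge0.
have tt : t ^+ 2 = b * c by rewrite sqr_sqrtr.
have r31 : 1 <= r ^+ 3 by rewrite exprn_ege1.
have [a_ge0 d_ge0] := (ltW a0, ltW d0).
have adm0 : 0 <= a * d * m ^+ 2 by rewrite !mulr_ge0 ?exprn_ge0.
have h1 : a * d * m ^+ 2 * (b * c) <= r ^+ 3 * (a * b * c * d * m ^+ 2).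
  have -> : a * b * c * d * m ^+ 2 = a * d * m ^+ 2 * (b * c) by ring.
  by rewrite ler_peMl // mulr_ge0.
have pos1 : 0 <= r ^+ 3 * (m ^+ 2 * r ^+ 4) by rewrite !mulr_ge0 ?exprn_ge0.
have pos2 : 0 <= r ^+ 3 * (a * b * c * d * m ^+ 2).
  by apply: le_trans h1; rewrite mulr_ge0.
suff h2 : a * d * m ^+ 2 * (t * r ^+ 4) <=
    r ^+ 3 * (a * b * c * d * m ^+ 2) + r ^+ 3 * (m ^+ 2 * r ^+ 4) by lra.
have [tr|rt] := lerP t r.
  have ad : a * d <= r ^+ 2.
    apply: (@le_trans _ _ (b * c)); last by rewrite -tt lerXn2r ?nnegrE.
    apply: (@le_trans _ _ c); last by rewrite ler_peMl // (le_trans ler01).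
    by rewrite -[c]mulr1 ler_pM.
  have : a * d * t <= r ^+ 2 * r by rewrite ler_pM // mulr_ge0.
  rewrite -exprSr => /(ler_wpM2r (_ : 0 <= m ^+ 2 * r ^+ 4)).
  have -> : a * d * t * (m ^+ 2 * r ^+ 4) = a * d * m ^+ 2 * (t * r ^+ 4) by ring.
  by rewrite mulr_ge0 ?exprn_ge0 // => /(_ isT); lra.
have h : t * r <= b * c by rewrite -tt expr2 ler_wpM2l // ltW.
have := ler_wpM2l (_ : 0 <= a * d * m ^+ 2 * r ^+ 3) h.
rewrite mulr_ge0 ?exprn_ge0 // => /(_ isT).
have -> : a * d * m ^+ 2 * r ^+ 3 * (t * r) = a * d * m ^+ 2 * (t * r ^+ 4) by ring.
have -> : a * d * m ^+ 2 * r ^+ 3 * (b * c) = r ^+ 3 * (a * b * c * d * m ^+ 2) by ring.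
by lra.
Qed.

Section Sizes.
Context {R : realType} (D : data R).
Variables U V : {set dvertex D}.
Hypothesis dUV : [disjoint U & V].

Lemma size_aC : size_a V U = size_c U V.
Proof. by rewrite /size_a /size_c cut_betweenC. Qed.

Lemma size_a_ge1 : 1 <= size_a U V.
Proof.
rewrite -expR0 ler_expR subr_ge0; apply: cut_between_le_net_cut => //.
  exact: netR_ends_neq0.
exact: netR_weight_ge0.
Qed.

Lemma size_d_gt0 : 0 < size_d U V.
Proof. by rewrite divr_gt0 ?mulr_gt0 ?expR_gt0. Qed.

Lemma size_abcd :
  size_a U V * size_b U V * size_c U V * size_d U V = expR (cost (netR D) U V).
Proof.
have d0 := size_d_gt0; rewrite /size_b.
have -> : expR (cost (netR D) U V) = size_a U V * size_c U V * expR (cut_between (netR D) U V).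
  by rewrite -!expRD /cost; congr expR; ring.
by field; exact: lt0r_neq0.
Qed.

(** [b] is the cost of the contraction divided by the size of its result. *)
Lemma size_b_ge1 : 1 <= size_b U V.
Proof.
have a0 : 0 < size_a U V by apply: expR_gt0.
have c0 : 0 < size_c U V by apply: expR_gt0.
have d0 := size_d_gt0.
have acd : size_a U V * size_c U V * size_d U V = expR (net_cut (netR D) (U :|: V)).
  by rewrite /size_d mulrC divfK // gt_eqF // mulr_gt0.
have : size_a U V * size_c U V * size_d U V <=
    size_b U V * (size_a U V * size_c U V * size_d U V).
  have -> : size_b U V * (size_a U V * size_c U V * size_d U V) =
    size_a U V * size_b U V * size_c U V * size_d U V by ring.
  rewrite size_abcd acd ler_expR; apply: net_cutU_le_cost => //.
    exact: netR_ends_neq0.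
  exact: netR_weight_ge0.
by rewrite ler_pMl // mulr_gt0 // mulr_gt0.
Qed.

Lemma graph_size_d_le1 : is_graph (dnet D) -> size_d U V <= 1.
Proof.
move=> gD; rewrite ler_pdivrMr ?mul1r ?mulr_gt0 ?expR_gt0 // -expRD ler_expR.
apply: graph_net_cutU => //.
- exact: netR_ends_neq0.
- exact: netR_weight_ge0.
- by move=> e; apply: gD.
Qed.

End Sizes.

Section SCost.
Context {R : realType} (D : data R) (m : R).
Hypothesis m1 : 1 <= m.

Lemma S_cost_le_sqrt (p : {set dvertex D} * {set dvertex D}) : [disjoint p.1 & p.2] ->
  S_cost m p <= 4 * Num.sqrt m * (expR (cost (netR D) p.1 p.2) * m ^+ 2).
Proof.
case: p => U V /= dUV; have dVU : [disjoint V & U] by rewrite disjoint_sym.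
rewrite -(size_abcd U V).
have a1 := size_a_ge1 dUV; have c1 := size_a_ge1 dVU; rewrite size_aC in c1.
have b1 := size_b_ge1 dUV; have d0 := size_d_gt0 U V.
case: ifP => _; first by apply: sketched_cost_le_sqrt => //; apply: expR_gt0.
have -> : size_a U V * size_b U V * size_c U V * size_d U V =
  size_c U V * size_b U V * size_a U V * size_d U V by ring.
by apply: sketched_cost_le_sqrt => //; apply: expR_gt0.
Qed.

Lemma S_cost_le_graph (p : {set dvertex D} * {set dvertex D}) : [disjoint p.1 & p.2] ->
  is_graph (dnet D) ->
  S_cost m p <= m `^ (3 / 8) *
    (4 * (expR (cost (netR D) p.1 p.2) * m ^+ 2) + 2 * (m ^+ 2 * Num.sqrt m)).
Proof.
case: p => U V /= dUV gD; have dVU : [disjoint V & U] by rewrite disjoint_sym.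
rewrite -(size_abcd U V).
have a1 := size_a_ge1 dUV; have c1 := size_a_ge1 dVU; rewrite size_aC in c1.
have b1 := size_b_ge1 dUV; have d0 := size_d_gt0 U V.
have d1 := graph_size_d_le1 dUV gD.
rewrite /S_cost; case: (lerP (size_a U V)) => ac.
  by apply: sketched_cost_le_graph => //; apply: expR_gt0.
have -> : size_a U V * size_b U V * size_c U V * size_d U V =
  size_c U V * size_b U V * size_a U V * size_d U V by ring.
by apply: sketched_cost_le_graph => //; [apply: expR_gt0 | apply: ltW].
Qed.

End SCost.

(** * The algorithm against one embedding *)

Section Assembly.
Context {R : realType} {D : data R} (G : embedding D).
Notation H := (combined G).
Notation EL := (embedding_edges G).
Variables (T0 : ctree (dvertex D)) (TB : ctree (dvertex D + evertex G)%type).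
Hypotheses (T0_tree : contraction_tree T0) (TB_tree : contraction_tree TB).
Hypothesis TB_T0 : constrained TB T0.
Variables (rk : dvertex D + evertex G -> nat) (lam m kappa : R).
Hypothesis order : sketch_order rk.
Hypothesis lam_ge0 : 0 <= lam.
Hypothesis lam_dim : forall j, lam <= weight (dnet D) (sk j).
Hypothesis lam_out : forall z, lam <= out_cut rk (inr z).
Hypothesis kappa_ge1 : 1 <= kappa.
Hypothesis m_ge1 : 1 <= m.
Hypothesis m_le : m <= kappa * expR lam.

Let C := tree_cost H TB.
Let spent := realized_cost TB.

Let spent_ge0 p : 0 <= spent p := realized_cost_ge0 TB p.
Let uT0 : uniq (leaves T0) := contraction_tree_uniq T0_tree.
Let kappa_ge0 : 0 <= kappa := le_trans ler01 kappa_ge1.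
Let m_ge0 : 0 <= m := le_trans ler01 m_ge1.

Let sum_spent : \sum_(p <- contractions T0) spent p <= 2 * C.
Proof. exact: sum_realized_cost. Qed.

Let C_ge0 : 0 <= C.
Proof. by apply: sumr_ge0 => *; apply: expR_ge0. Qed.

Lemma sum_part_le (P : pred ({set dvertex D} * {set dvertex D})) :
  \sum_(p <- contractions T0 | P p) spent p <= 2 * C.
Proof.
apply: le_trans sum_spent; rewrite big_mkcond; apply: ler_sum => p _.
by case: ifP.
Qed.

(** The algorithm applies the matrix of e_j at the best tensor of the chain, so it
costs at most what it would at the tensor given by [sketch_edge_charge].  The
contractions before it see e_j at full size, the later ones at size [m], as [TB]
does up to [kappa]. *)
Lemma X_cost_le j : exists2 q, q \in contractions TB &
  ((sk_in (data_part q.1) == [set j]) || (sk_in (data_part q.2) == [set j])) /\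
  X_cost m T0 j <= kappa * step_cost q +
    kappa * \sum_(p <- contractions T0 | in_D j p) spent p.
Proof.
have [W [q [eW qT qj main early]]] :=
  sketch_edge_charge T0_tree TB_tree TB_T0 order lam_dim lam_out j.
exists q => //; split=> //.
have XW : X_cost m T0 j <= X_cost_at m T0 j W.
  case: eW => [->|[p pT [pD ->]]]; first exact: bigmin_le_id.
  by apply: ge_bigmin_seq pT pD.
apply: le_trans XW _; apply: lerD.
  apply: (@le_trans _ _ (kappa * (expR (net_cut (netR D) W) * dim_size j * expR lam))).
    rewrite mulrCA ler_wpM2l // mulr_ge0 ?expR_ge0 //.
  by rewrite ler_wpM2l.
rewrite mulr_sumr big_seq_cond [leRHS]big_seq_cond; apply: ler_sum => p /andP[pT pD].
case: ifP => [pW|_].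
  apply: le_trans (early _ pT pD pW) _.
  by rewrite ler_peMl.
apply: (@le_trans _ _ (kappa * (expR (cost (netR D) p.1 p.2) * expR lam))).
  by rewrite mulrCA ler_wpM2l ?expR_ge0.
rewrite ler_wpM2l //; apply: (realized_cost_ge_sketched TB_tree TB_T0 order lam_dim lam_out pT).
by move/eqP: pD => ->; apply/set0Pn; exists j; rewrite inE.
Qed.

(** The classes D(e_j) are disjoint. *)
Lemma sum_in_D : \sum_(j < nsk D) \sum_(p <- contractions T0 | in_D j p) spent p <= 2 * C.
Proof.
rewrite (exchange_big_dep predT) //=; apply: le_trans sum_spent; apply: ler_sum => p _.
have [j0 /eqP j0D|nD] := pickP (fun j => in_D j p).
  rewrite (big_pred1 j0) // => j; rewrite /in_D j0D.
  by apply/eqP/eqP => [/set1_inj|->].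
by rewrite big_pred0.
Qed.

Lemma sum_X_cost : \sum_(j < nsk D) X_cost m T0 j <= 4 * kappa * C.
Proof.
(* The part of [X_cost] paid by a single contraction of [TB]. *)
pose F j := X_cost m T0 j - kappa * \sum_(p <- contractions T0 | in_D j p) spent p.
have hF : \sum_(j < nsk D) F j <= 2 * \sum_(q <- contractions TB) (kappa * step_cost q).
  apply: (@double_counting_exists _ _ _ 2 _ _ (fun j q =>
    (sk_in (data_part q.1) == [set j]) || (sk_in (data_part q.2) == [set j]))).
  - by move=> q; rewrite mulr_ge0 // step_cost_ge0.
  - move=> q; have one (S : {set 'I_(nsk D)}) :
        (count (fun j => S == [set j]) (index_enum 'I_(nsk D)) <= 1)%N.
      case: (pickP (fun j => S == [set j])) => [j0 /eqP ->|none].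
        rewrite (eq_count (a2 := pred1 j0)) => [|j /=]; last first.
          by rewrite eq_sym; apply/eqP/eqP => [/set1_inj|->].
        by rewrite count_uniq_mem ?index_enum_uniq // mem_index_enum.
      by rewrite (eq_count (a2 := pred0)) ?count_pred0.
    rewrite (leq_trans _ (leq_add (one (sk_in (data_part q.1)))
      (one (sk_in (data_part q.2))))) //.
    by rewrite -[leqRHS]count_predUI; apply: leq_addr.
  - move=> j _; have [q qT [qj Xj]] := X_cost_le j; exists q; split=> //.
    by rewrite /F lerBlDr.
have -> : \sum_(j < nsk D) X_cost m T0 j = \sum_(j < nsk D) F j +
    kappa * \sum_(j < nsk D) \sum_(p <- contractions T0 | in_D j p) spent p.
  by rewrite mulr_sumr -big_split; apply: eq_bigr => j _; rewrite /F /= subrK.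
have := ler_wpM2l kappa_ge0 sum_in_D.
move: hF; rewrite -mulr_sumr; have -> : \sum_(q <- contractions TB) step_cost q = C by [].
lra.
Qed.

Lemma sum_I_cost : \sum_(p <- contractions T0 | in_I p) I_cost m p <= 2 * kappa * C.
Proof.
apply: (@le_trans _ _ (\sum_(p <- contractions T0 | in_I p) kappa * spent p)); last first.
  by rewrite -mulr_sumr [2 * kappa]mulrC -mulrA ler_wpM2l // sum_part_le.
rewrite big_seq_cond [leRHS]big_seq_cond; apply: ler_sum => p /andP[pT _].
rewrite /I_cost; case: ifPn => [_|sk0].
  rewrite mulr1; apply: le_trans (realized_cost_ge_data TB_tree TB_T0 pT) _.
  by rewrite ler_peMl.
apply: (@le_trans _ _ (kappa * (expR (cost (netR D) p.1 p.2) * expR lam))).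
  by rewrite mulrCA ler_wpM2l ?expR_ge0.
by rewrite ler_wpM2l //; apply: (realized_cost_ge_sketched TB_tree TB_T0 order lam_dim lam_out pT).
Qed.

Lemma merge_square_le p : p \in contractions T0 -> in_S p ->
  expR (cost (netR D) p.1 p.2) * m ^+ 2 <= kappa ^+ 2 * spent p.
Proof.
move=> pT pS; apply: (@le_trans _ _ (kappa ^+ 2 *
    (expR (cost (netR D) p.1 p.2) * (expR lam * expR lam)))).
  have -> : kappa ^+ 2 * (expR (cost (netR D) p.1 p.2) * (expR lam * expR lam)) =
    expR (cost (netR D) p.1 p.2) * (kappa * expR lam) ^+ 2 by ring.
  rewrite ler_wpM2l ?expR_ge0 // lerXn2r ?nnegrE //.
  by rewrite mulr_ge0 ?expR_ge0.
by rewrite ler_wpM2l ?exprn_ge0 //; apply: (realized_cost_ge_merge TB_tree TB_T0 order lam_dim lam_out pT).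
Qed.

Lemma sum_S_cost : \sum_(p <- contractions T0 | in_S p) S_cost m p <=
  8 * kappa ^+ 2 * Num.sqrt m * C.
Proof.
apply: (@le_trans _ _ (\sum_(p <- contractions T0 | in_S p)
    (4 * Num.sqrt m * kappa ^+ 2) * spent p)); last first.
  have -> : 8 * kappa ^+ 2 * Num.sqrt m * C =
    (4 * Num.sqrt m * kappa ^+ 2) * (2 * C) by ring.
  rewrite -mulr_sumr ler_wpM2l ?sum_part_le //.
  by rewrite !mulr_ge0 ?exprn_ge0 ?sqrtr_ge0.
rewrite big_seq_cond [leRHS]big_seq_cond; apply: ler_sum => p /andP[pT pS].
apply: le_trans (S_cost_le_sqrt m_ge1 (contraction_disjoint uT0 pT)) _.
by rewrite -[leRHS]mulrA ler_wpM2l ?merge_square_le // mulr_ge0 ?sqrtr_ge0.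
Qed.

(** Each merge of two nonempty sets of sketched edges lowers the number of
such sets by one. *)
Lemma count_in_S T : uniq (leaves T) ->
  (count (@in_S _ D) (contractions T) <= #|sk_in (leaf_set T)|.-1)%N.
Proof.
elim: T => [//|l IHl r IHr] ulr /=; rewrite count_cat.
have {}IHl := IHl (uniq_leaves_l ulr); have {}IHr := IHr (uniq_leaves_r ulr).
have dsk : [disjoint sk_in (leaf_set l) & sk_in (leaf_set r)].
  apply/pred0P => j /=; rewrite !in_sk_in.
  case jl: (_ \in leaf_set l) => //=; exact: (disjointFr (leaf_set_disjoint ulr) jl).
have -> : #|sk_in (leaf_set (Node l r))| =
    (#|sk_in (leaf_set l)| + #|sk_in (leaf_set r)|)%N.
  rewrite leaf_set_Node sk_inU cardsU (_ : _ :&: _ = finset.set0) ?cards0 ?subn0 //.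
  by apply/eqP; rewrite setI_eq0.
rewrite /in_S /=; move: IHl IHr.
case: #|sk_in (leaf_set l)| => [|nl]; case: #|sk_in (leaf_set r)| => [|nr] //=;
  rewrite ?add0n ?addn0.
- by rewrite !leqn0 => /eqP-> /eqP->.
- by rewrite leqn0 => /eqP->.
- by rewrite leqn0 => h /eqP->; rewrite addn0.
- by move=> h1 h2; rewrite add1n addnS ltnS leq_add.
Qed.

Hypothesis one_output : #|[set f | dangling (enet G) f]| = 1%N.

(** When [lam = 0] each realized contraction already costs at least [1]. *)
Lemma merges_le : expR (5 / 2 * lam) * (count (@in_S _ D) (contractions T0))%:R <= 4 * C.
Proof.
have [lam0|lam_gt0] := eqVneq lam 0.
  rewrite lam0 mulr0 expR0 mul1r; apply: (@le_trans _ _ (2 * C)); last by have := C_ge0; lra.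
  apply: le_trans (sum_part_le (@in_S _ D)).
  rewrite -sum1_count natr_sum big_seq_cond [leRHS]big_seq_cond.
  apply: ler_sum => p /andP[pT _]; apply: le_trans (realized_cost_ge_data TB_tree TB_T0 pT).
  rewrite -expR0 ler_expR; apply: cost_ge0.
  - exact: netR_ends_neq0.
  - exact: netR_weight_ge0.
  - exact: contraction_disjoint pT.
have {lam_gt0} : 0 < lam by rewrite lt_neqAle eq_sym lam_gt0.
move=> lam_gt0.
pose F (A B : {set dvertex D + evertex G}) := expR (flow_cost EL A B).
have F0 A B : 0 <= F A B by apply: expR_ge0.
have Fact A B : F (A :&: active_vertices G) (B :&: active_vertices G) = F A B.
  by rewrite /F flow_cost_act.
have hasTB : has [in active_vertices G] (leaves TB).
  apply/hasP; have [z za _] := active_not_sketched G; exists z => //.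
  by rewrite (perm_mem TB_tree) mem_enum.
have [T' eT' cT'] := prune_tree F0 Fact hasTB.
have uT' : uniq (leaves T').
  by rewrite eT' filter_uniq // contraction_tree_uniq.
have aT' : leaf_set T' = active_vertices G.
  apply/setP => x; rewrite leaf_setE eT' mem_filter (perm_mem TB_tree) mem_enum.
  by rewrite andbT.
have := merges_are_expensive (@combined_weight_ge0 _ _ G) (@embedding_ends_active _ _ G)
  (@out_edgesP _ _ G rk) (@out_edges_disjoint _ _ G rk)
  (out_edges_weight order lam_dim lam_out) (sketched_active G)
  (sketched_low order) (@sketched_out _ _ G rk) (active_not_sketched G)
  (embedding_dangling_unique one_output) lam_gt0 uT' aT'.
have -> : #|sketched_vertices G| = nsk D.
  rewrite card_imset ?card_ord // => i j [] /skv_inj //.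
move=> h; apply: (@le_trans _ _ (expensive lam * (nsk D).-1%:R)).
  rewrite ler_wpM2l ?expR_ge0 // ler_nat (leq_trans (count_in_S uT0)) //.
  rewrite (contraction_tree_leaf_set T0_tree).
  by rewrite -!subn1 leq_sub2r // -[leqRHS]card_ord max_card.
apply: le_trans h _; rewrite ler_wpM2l // (le_trans cT') //.
rewrite /C /tree_cost big_seq [leRHS]big_seq; apply: ler_sum => q qT.
rewrite ler_expR combined_costE; last first.
  exact: (contraction_disjoint (contraction_tree_uniq TB_tree) qT).
rewrite lerDr; apply: cost_ge0.
- exact: netR_ends_neq0.
- exact: netR_weight_ge0.
- apply: data_part_disjoint.
  exact: (contraction_disjoint (contraction_tree_uniq TB_tree) qT).
Qed.

(** This is [m <= kappa * expR lam] raised to the power [5/2]. *)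
Lemma m_five_halves_le : m ^+ 2 * Num.sqrt m <= kappa ^+ 3 * expR (5 / 2 * lam).
Proof.
have e0 : 0 <= expR lam by apply: expR_ge0.
have ke0 : 0 <= kappa * expR lam by apply: mulr_ge0.
have ks : Num.sqrt kappa <= kappa.
  rewrite -{2}(sqr_sqrtr kappa_ge0) expr2 ler_peMr ?sqrtr_ge0 //.
  by rewrite -[leLHS]sqrtr1 ler_sqrt // (lt_le_trans ltr01).
have es : Num.sqrt (expR lam) = expR (lam / 2).
  have -> : expR lam = expR (lam / 2) ^+ 2.
    by rewrite expr2 -expRD; congr expR; field.
  by rewrite sqrtr_sqr ger0_norm ?expR_ge0.
have -> : expR (5 / 2 * lam) = expR lam ^+ 2 * Num.sqrt (expR lam).
  by rewrite es expr2 -!expRD; congr expR; field.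
apply: (@le_trans _ _ ((kappa * expR lam) ^+ 2 * Num.sqrt (kappa * expR lam))).
  by rewrite ler_pM ?exprn_ge0 ?sqrtr_ge0 ?lerXn2r ?nnegrE ?ler_wsqrtr.
rewrite sqrtrM //.
have -> : (kappa * expR lam) ^+ 2 * (Num.sqrt kappa * Num.sqrt (expR lam)) =
  (kappa ^+ 2 * Num.sqrt kappa) * (expR lam ^+ 2 * Num.sqrt (expR lam)) by ring.
rewrite ler_wpM2r ?mulr_ge0 ?exprn_ge0 ?sqrtr_ge0 //.
by rewrite [leRHS]exprSr ler_wpM2l ?exprn_ge0.
Qed.

Lemma sum_S_cost_graph : is_graph (dnet D) ->
  \sum_(p <- contractions T0 | in_S p) S_cost m p <= 16 * kappa ^+ 3 * m `^ (3 / 8) * C.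
Proof.
move=> gD; pose r := m `^ (3 / 8); have r0 : 0 <= r by apply: powR_ge0.
apply: (@le_trans _ _ (\sum_(p <- contractions T0 | in_S p)
    (r * (4 * kappa ^+ 2) * spent p + r * (2 * (m ^+ 2 * Num.sqrt m))))).
  rewrite big_seq_cond [leRHS]big_seq_cond; apply: ler_sum => p /andP[pT pS].
  apply: le_trans (S_cost_le_graph m_ge1 (contraction_disjoint uT0 pT) gD) _.
  rewrite -/r -mulrA -mulrDr ler_wpM2l // lerD2r -mulrA ler_wpM2l //.
  exact: merge_square_le.
rewrite big_split /= -mulr_sumr big_const_seq iter_addr_0.
have h1 := ler_wpM2l (_ : 0 <= r * (4 * kappa ^+ 2)) (sum_part_le (@in_S _ D)).
have {}h1 := h1 (mulr_ge0 r0 (mulr_ge0 (ler0n _ _) (exprn_ge0 _ kappa_ge0))).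
have k23 : kappa ^+ 2 <= kappa ^+ 3 by rewrite [leRHS]exprSr ler_peMr ?exprn_ge0.
have rC0 : 0 <= r * C by rewrite mulr_ge0.
have h3 := ler_wpM2r rC0 k23.
pose n : R := (count (@in_S _ D) (contractions T0))%:R.
have h2 : m ^+ 2 * Num.sqrt m * n <= kappa ^+ 3 * (4 * C).
  apply: (@le_trans _ _ (kappa ^+ 3 * expR (5 / 2 * lam) * n)).
    by rewrite ler_wpM2r ?ler0n // m_five_halves_le.
  by rewrite -mulrA ler_wpM2l ?exprn_ge0 // merges_le.
have {}h2 := ler_wpM2l r0 h2; rewrite -/r -/n. lra.
Qed.

End Assembly.

(** * The approximation ratio *)

Theorem theorem4p2 (R : realType) (k1 k2 : R) (hk1 : 0 < k1) (hk2 : 0 < k2) :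
  exists2 K : R, 0 < K &
  forall (D : data R) (T0 : ctree (dvertex D)) (eps del m : R),
    contraction_tree T0 ->
    0 < eps -> 0 < del < 1 -> 1 <= m ->
    theta k1 k2 m ((nsk D)%:R * ln (1 / del) / eps ^+ 2) ->
    (forall j : 'I_(nsk D), m < dim_size j) ->
    ((alg_cost m T0)%:E <=
       (K * Num.sqrt m)%:E * c_opt k1 k2 eps del m T0)%E /\
    (is_graph (dnet D) ->
     ((alg_cost m T0)%:E <=
       (K * m `^ (3 / 8))%:E * c_opt k1 k2 eps del m T0)%E).
Proof.
(* Capping [k1] at 1 makes [k * m] smaller than the sizes of the sketched edges,
   which are only known to exceed [m]. *)
pose k := Num.min 1 k1.
have k_gt0 : 0 < k by rewrite /k lt_min ltr01.
have k_le1 : k <= 1 by rewrite /k ge_min lexx.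
have k_lek1 : k <= k1 by rewrite /k ge_min lexx orbT.
pose kappa := k^-1.
have kappa1 : 1 <= kappa by rewrite /kappa invf_ge1.
have kappa0 : 0 < kappa by rewrite invr_gt0.
(* 22 = 4 + 2 + 16: the constants of [sum_X_cost], [sum_I_cost] and
   [sum_S_cost_graph]. *)
exists (22 * kappa ^+ 3); first by rewrite mulr_gt0 ?exprn_gt0.
move=> D T0 eps del m T0_tree _ _ m1 _ dim_gt.
have m0 : 0 < m by apply: lt_le_trans m1.
(* The maximum keeps [lam] nonnegative when [m < k^-1]. *)
pose lam := ln (Num.max 1 (k * m)).
have max0 : 0 < Num.max 1 (k * m) by rewrite lt_max ltr01.
have e_lam : expR lam = Num.max 1 (k * m) by rewrite lnK.
have lam0 : 0 <= lam by rewrite ln_ge0 // le_max lexx.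
have lam_dim (j : 'I_(nsk D)) : lam <= weight (dnet D) (sk j).
  rewrite -ler_expR e_lam; apply: le_trans (ltW (dim_gt j)).
  by rewrite ge_max m1 ler_piMl // ltW.
have m_le : m <= kappa * expR lam.
  by rewrite -ler_pdivrMl // invrK e_lam le_max lexx orbT.
have bound (c : R) : 0 < c ->
    (forall (G : embedding D) (TB : ctree (dvertex D + evertex G)%type)
      (rk : dvertex D + evertex G -> nat),
      contraction_tree TB -> constrained TB T0 -> sketch_order rk ->
      (forall z, lam <= out_cut rk (inr z)) ->
      #|[set f | dangling (enet G) f]| = 1%N ->
      alg_cost m T0 <= c * tree_cost (combined G) TB) ->
    ((alg_cost m T0)%:E <= c%:E * c_opt k1 k2 eps del m T0)%E.
  move=> c0 h; have -> : alg_cost m T0 = c * (c^-1 * alg_cost m T0).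
    by rewrite mulVKf // gt_eqF.
  rewrite EFinM lee_pmul2l //; apply: le_ereal_inf_tmp => _ [G [TB [cl sz TBt con ->]]].
  rewrite lee_fin ler_pdivrMl //.
  have [one _ [rk ord out]] := cl; apply: h TBt con ord _ one => z.
  apply: le_trans (out z); rewrite ler_ln ?posrE ?expR_gt0 //.
  rewrite ge_max; apply/andP; split.
    rewrite -expR0 ler_expR; apply: sumr_ge0 => f _; by have [] := enet_tn f.
  by apply: le_trans sz; rewrite ler_wpM2r // ltW.
have kp23 : kappa ^+ 2 <= kappa ^+ 3.
  by rewrite [leRHS]exprSr ler_peMr ?exprn_ge0 // ltW.
have kp13 : kappa <= kappa ^+ 3.
  by apply: le_trans kp23; rewrite expr2 ler_peMr // ltW.
have total (s : R) : 1 <= s ->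
    (forall (G : embedding D) (TB : ctree (dvertex D + evertex G)%type)
      (rk : dvertex D + evertex G -> nat),
      contraction_tree TB -> constrained TB T0 -> sketch_order rk ->
      (forall z, lam <= out_cut rk (inr z)) ->
      #|[set f | dangling (enet G) f]| = 1%N ->
      \sum_(p <- contractions T0 | in_S p) S_cost m p <=
        16 * kappa ^+ 3 * s * tree_cost (combined G) TB) ->
    ((alg_cost m T0)%:E <= (22 * kappa ^+ 3 * s)%:E * c_opt k1 k2 eps del m T0)%E.
  move=> s1 h; have s0 : 0 < s by apply: lt_le_trans s1.
  apply: bound => [|G TB rk TBt con ord out one]; first by rewrite !mulr_gt0 ?exprn_gt0.
  have hS := h _ _ _ TBt con ord out one.
  have hX := sum_X_cost T0_tree TBt con ord lam_dim out kappa1 m_le.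
  have hI := sum_I_cost T0_tree TBt con ord lam_dim out kappa1 m_le.
  rewrite /alg_cost.
  have C0 : 0 <= tree_cost (combined G) TB by apply: sumr_ge0 => *; apply: expR_ge0.
  have := ler_wpM2r C0 kp13.
  have : kappa ^+ 3 * tree_cost (combined G) TB <= kappa ^+ 3 * tree_cost (combined G) TB * s.
    by rewrite ler_peMr // mulr_ge0 // exprn_ge0 // ltW.
  lra.
split=> [|gD]; apply: total.
- by rewrite -[leLHS]sqrtr1 ler_sqrt // ltW.
- move=> G TB rk TBt con ord out one.
  apply: le_trans (sum_S_cost T0_tree TBt con ord lam_dim out kappa1 m1 m_le) _.
  have C0 : 0 <= tree_cost (combined G) TB by apply: sumr_ge0 => *; apply: expR_ge0.
  rewrite ler_wpM2r // ler_wpM2r ?sqrtr_ge0 //.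
  have : 0 <= kappa ^+ 2 by rewrite exprn_ge0 // ltW.
  lra.
- by rewrite -[leLHS](powRr0 m) ler_powR // divr_ge0.
- move=> G TB rk TBt con ord out one.
  exact: (sum_S_cost_graph T0_tree TBt con ord lam0 lam_dim out kappa1 m1 m_le one gD).
Qed.
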